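(* For any triplet $\xi=(G,\mathcal{L},\mathcal{A})$ we have $$\limsup_{k\to\infty}\ (\rho(\xi))^{-k}\max_{\alpha\in\mathcal{C}(G),\ |\alpha|=k}\rho(\Pi_\alpha)=1 .$$
   Context: A triplet (system) $\xi=(G,\mathcal{L},\mathcal{A})$ consists of: a directed multigraph $G$ with vertices $1,\dots,n$ (loops and multiple edges allowed, finitely many edges); linear spaces $\mathcal{L}=(L_1,\dots,L_n)$ of finite dimensions $d_i\ge 1$, with $L_i$ attached to vertex $i$; and, for every edge from $i$ to $j$, a linear operator $A_{ji}:L_i\to L_j$. $\mathcal{A}$ is the family of all these operators. The multigraph is not assumed strongly connected and the triplet is not assumed irreducible (irreducible means that there is no choice of subspaces $L_i'\subset L_i$, not all zero and with $L_i'\neq L_i$ for at least one $i$, such that every operator $A_{ji}$ of $\mathcal{A}$ maps $L_i'$ into $L_j'$). A path $\alpha$ is a sequence of consecutive edges; $|\alpha|$ is its number of edges. For a path along vertices $i_1\to i_2\to\dots\to i_{k+1}$ with operators $A_{i_{s+1}i_s}$, put $\Pi_\alpha=A_{i_{k+1}i_k}\cdots A_{i_2i_1}:L_{i_1}\to L_{i_{k+1}}$. The path is closed if $i_1=i_{k+1}$; $\mathcal{C}(G)$ is the set of all closed paths. For a closed path, $\rho(\Pi_\alpha)$ is the usual spectral radius (largest modulus of eigenvalues). A multinorm is a collection of norms $\|\cdot\|_i$ on $L_i$, $i=1,\dots,n$; for an operator $A:L_i\to L_j$, $\|A\|=\sup_{\|x\|_i=1}\|Ax\|_j$. The joint spectral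 radius of the triplet is $\rho(\xi)=\lim_{k\to\infty}\max_{|\alpha|=k}\|\Pi_\alpha\|^{1/k}$ (the limit exists and does not depend on the multinorm).
   Formalization: The theorem is proved for triplets with ρ(ξ) > 0; when ρ(ξ) = 0 (for example an acyclic graph or a single loop with the zero operator) the factor ρ(ξ)^{-k} is undefined. *)

(* Defs.v *)
From HB Require Import structures.
From mathcomp Require Import all_boot all_order all_algebra.
From mathcomp.real_closed Require Import complex.
From mathcomp Require Import all_classical all_reals all_analysis.

Set Implicit Arguments.
Unset Strict Implicit.
Unset Printing Implicit Defensive.

Import passmx.
Import Order.TTheory GRing.Theory Num.Theory.
Import numFieldNormedType.Exports.
Local Open Scope classical_set_scope.
Local Open Scope ring_scope.

(* The linear spaces are all real or all complex. *)
Variant scalars := RealScalars | ComplexScalars.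

Definition scalar (R : realType) (s : scalars) : numFieldType :=
  match s with RealScalars => R | ComplexScalars => R[i] end.

Definition to_complex (R : realType) (s : scalars) : scalar R s -> R[i] :=
  match s with RealScalars => real_complex R | ComplexScalars => id end.

(* The real-valued modulus (on R[i] the library norm is itself R[i]-valued). *)
Definition cmod (R : realType) (z : R[i]) : R := complex.ComplexField.Normc.normc z.

(* The multigraph is given by its finite types of parallel edges [edge i j],
   from vertex i to vertex j. *)
Record triplet (R : realType) (s : scalars) := Triplet {
  nvert : nat;
  space : 'I_nvert -> vectType (scalar R s);
  space_gt0 : forall i, (0 < \dim {: space i})%N;
  edge : 'I_nvert -> 'I_nvert -> finType;
  op : forall i j, edge i j -> 'Hom(space i, space j) }.

Inductive gpath (R : realType) (s : scalars) (xi : triplet R s) :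
    'I_(nvert xi) -> 'I_(nvert xi) -> Type :=
| gpath_nil i : gpath i i
| gpath_rcons i j l : gpath i j -> edge j l -> gpath i l.

Fixpoint plen (R : realType) (s : scalars) (xi : triplet R s)
    (i j : 'I_(nvert xi)) (p : gpath i j) : nat :=
  match p with
  | gpath_nil _ => 0
  | gpath_rcons _ _ _ q _ => (plen q).+1
  end.

Fixpoint pprod (R : realType) (s : scalars) (xi : triplet R s)
    (i j : 'I_(nvert xi)) (p : gpath i j) : 'Hom(space i, space j) :=
  match p with
  | gpath_nil _ => \1%VF
  | gpath_rcons _ _ _ q e => (op e \o pprod q)%VF
  end.

Record is_norm (R : realType) (s : scalars) (V : vectType (scalar R s))
    (N : V -> R) : Prop := IsNorm {
  norm_triangle : forall x y, N (x + y) <= N x + N y;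
  norm_scale : forall a x, N (a *: x) = cmod (to_complex a) * N x;
  norm_eq0 : forall x, N x = 0 -> x = 0 }.

Record multinorm (R : realType) (s : scalars) (xi : triplet R s) := Multinorm {
  mnorm : forall i : 'I_(nvert xi), space i -> R;
  mnormP : forall i, is_norm (@mnorm i) }.

Definition opnorm (R : realType) (s : scalars) (xi : triplet R s)
    (N : multinorm xi) (i j : 'I_(nvert xi)) (f : 'Hom(space i, space j)) : R :=
  sup [set r | exists x : space i, mnorm N x = 1 /\ r = mnorm N (f x)].

(* For real spaces the complex eigenvalues are counted as well, hence the
   passage to the complex matrix of f. *)
Definition spectral_radius (R : realType) (s : scalars)
    (V : vectType (scalar R s)) (f : 'End(V)) : R :=
  let M := mxof (vbasis {:V}) (vbasis {:V}) f in
  sup [set r | exists z : R[i],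
    eigenvalue (map_mx (@to_complex R s) M) z /\ r = cmod z].

(* There are finitely many paths of length k, so this sup is the maximum; it
   is 0 when there is no such path. *)
Definition max_norm_root (R : realType) (s : scalars) (xi : triplet R s)
    (N : multinorm xi) (k : nat) : R :=
  sup [set r | exists (i j : 'I_(nvert xi)) (p : gpath i j),
    plen p = k /\ r = (opnorm N (pprod p)) `^ (k%:R^-1)].

Definition jsr (R : realType) (s : scalars) (xi : triplet R s)
    (N : multinorm xi) : R :=
  limn (max_norm_root N).

(* As above, a maximum, with value 0 when no closed path has length k. *)
Definition max_closed_spectral_radius (R : realType) (s : scalars)
    (xi : triplet R s) (k : nat) : R :=
  sup [set r | exists (i : 'I_(nvert xi)) (p : gpath i i),
    plen p = k /\ r = spectral_radius (pprod p)].

(* Main.v *)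
Require Import Defs.
From HB Require Import structures.
From mathcomp Require Import all_boot all_order all_algebra perm.
From mathcomp.real_closed Require Import complex.
From mathcomp Require Import all_classical all_reals all_analysis.
From mathcomp Require Import ring lra zify.

Set Implicit Arguments.
Unset Strict Implicit.
Unset Printing Implicit Defensive.

Import Order.TTheory GRing.Theory Num.Theory.
Import numFieldNormedType.Exports.
Local Open Scope classical_set_scope.
Local Open Scope ring_scope.

(** The operators of all edges are assembled into a finite family of complex
    matrices [A e] on the direct sum of the complexified spaces, each [A e] being
    zero outside one block. A product of the [A e] along a word is zero unless the
    word is a path, and is then the operator of the path placed in one block
    ([path_word], [word_path]). After division by the joint spectral radius, the
    norms of the words of length [k] are at most [B * r ^+ k] for every [r > 1] and
    some [B] ([subexponential]), and for every [k] some word of length [k] has norm at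
    least a constant [c > 0] ([nondecaying]).

    The upper bound follows by taking powers: an eigenvalue of modulus above 1 of
    a word [w] would make the norms of the words [w], [w w], [w w w] and so on grow
    exponentially ([subexponential_eigenvalue_le1]).

    For the lower bound, every [eps] and [K] must admit a word of length at least
    [K] with an eigenvalue of modulus at least [1 - eps]. Suppose first that all
    words are bounded. In a very long word that does not decay, all prefixes are
    bounded and bounded away from 0, so two prefixes [P] and [P Q], with [Q] of
    length at least [K], are close together. Then [P (1 - Q)] is small although [P]
    is not, hence [\det (1 - Q)] is small. This determinant is the product of
    the [1 - z] over the eigenvalues [z] of [Q], so some [z] is close to 1
    ([bounded_long_unit_eigenvalues]).

    In general, the vectors with bounded orbit form an invariant subspace. It is
    not zero: otherwise compactness of the sphere would give exponential growth
    ([exists_bounded_orbit]). If it is the whole space, all words are bounded.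
    If it is proper, the family is block triangular, and one of the two
    diagonal families is again non-decaying ([nondecaying_block]), because
    contracting diagonal blocks make the whole family contract. The eigenvalues
    of a diagonal block are eigenvalues of the whole word, so an induction on the
    dimension concludes ([nondecaying_long_unit_eigenvalues]). *)

(** * Modulus, entrywise norm and words of matrices *)

Section Modulus.
Variable R : realType.
Implicit Types x y : R[i].

Lemma cmod_ge0 x : 0 <= cmod x.
Proof. by case: x => a b; exact: sqrtr_ge0. Qed.

Lemma cmod0 : cmod 0 = 0 :> R.
Proof. exact: complex.ComplexField.Normc.normc0. Qed.

Lemma cmod1 : cmod 1 = 1 :> R.
Proof. exact: complex.ComplexField.Normc.normc1. Qed.

Lemma cmod_eq0 x : cmod x = 0 -> x = 0.
Proof. exact: complex.ComplexField.Normc.eq0_normc. Qed.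

Lemma cmodM x y : cmod (x * y) = cmod x * cmod y.
Proof. exact: complex.ComplexField.Normc.normcM. Qed.

Lemma cmodD x y : cmod (x + y) <= cmod x + cmod y.
Proof. exact: le_normcD. Qed.

Lemma cmodN x : cmod (- x) = cmod x.
Proof. exact: normcN. Qed.

Lemma cmodX x k : cmod (x ^+ k) = cmod x ^+ k.
Proof. by elim: k => [|k IH]; rewrite ?expr0 ?cmod1// !exprS cmodM IH. Qed.

Lemma cmod_real (r : R) : cmod r%:C%C = `|r|.
Proof. by rewrite /cmod /= expr0n /= addr0 sqrtr_sqr. Qed.

Lemma cmod_Re x : `|complex.Re x| <= cmod x.
Proof.
case: x => a b /=; rewrite -sqrtr_sqr ler_sqrt ?lerDl ?sqr_ge0//.
by rewrite addr_ge0 ?sqr_ge0.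
Qed.

Lemma cmod_Im x : `|complex.Im x| <= cmod x.
Proof.
case: x => a b /=; rewrite -sqrtr_sqr ler_sqrt ?lerDr ?sqr_ge0//.
by rewrite addr_ge0 ?sqr_ge0.
Qed.

Lemma cmod_le_ReIm x : cmod x <= `|complex.Re x| + `|complex.Im x|.
Proof.
rewrite -[leRHS]ger0_norm ?addr_ge0// -sqrtr_sqr.
case: x => a b /=; rewrite ler_sqrt ?sqr_ge0// sqrrD !real_normK ?num_real//.
by rewrite -addrA lerD2l lerDr mulrn_wge0 ?mulr_ge0.
Qed.

Lemma cmod_sum (I : Type) (r : seq I) (P : pred I) (F : I -> R[i]) :
  cmod (\sum_(i <- r | P i) F i) <= \sum_(i <- r | P i) cmod (F i).
Proof.
elim/big_ind2: _ => // [|a b c d ab cd]; first by rewrite cmod0.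
exact: le_trans (cmodD _ _) (lerD ab cd).
Qed.

Lemma cmod_prod (I : Type) (r : seq I) (P : pred I) (F : I -> R[i]) :
  cmod (\prod_(i <- r | P i) F i) = \prod_(i <- r | P i) cmod (F i).
Proof. by apply: big_morph => [a b|]; rewrite ?cmodM ?cmod1. Qed.

End Modulus.

Section EntryNorm.
Variable R : realType.

Definition enorm m n (M : 'M[R[i]]_(m, n)) : R := \sum_i \sum_j cmod (M i j).

Lemma enorm_ge0 m n (M : 'M[R[i]]_(m, n)) : 0 <= enorm M.
Proof. by rewrite sumr_ge0// => i _; rewrite sumr_ge0// => j _; rewrite cmod_ge0. Qed.

Lemma enorm0 m n : enorm (0 : 'M[R[i]]_(m, n)) = 0.
Proof. by rewrite /enorm big1// => i _; rewrite big1// => j _; rewrite mxE cmod0. Qed.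

Lemma cmod_le_enorm m n (M : 'M[R[i]]_(m, n)) i j : cmod (M i j) <= enorm M.
Proof.
rewrite /enorm (bigD1 i)//= (bigD1 j)//= -addrA lerDl addr_ge0//.
  by rewrite sumr_ge0// => k _; rewrite cmod_ge0.
by rewrite sumr_ge0// => k _; rewrite sumr_ge0// => l _; rewrite cmod_ge0.
Qed.

Lemma enorm_eq0 m n (M : 'M[R[i]]_(m, n)) : enorm M = 0 -> M = 0.
Proof.
move=> M0; apply/matrixP => i j; rewrite mxE; apply: cmod_eq0.
by apply/eqP; rewrite eq_le cmod_ge0 -M0 cmod_le_enorm.
Qed.

Lemma enorm_gt0 m n (M : 'M[R[i]]_(m, n)) : M != 0 -> 0 < enorm M.
Proof.
by move=> M0; rewrite lt_def enorm_ge0 andbT; apply: contra M0 => /eqP/enorm_eq0->.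
Qed.

Lemma enormD m n (M M' : 'M[R[i]]_(m, n)) : enorm (M + M') <= enorm M + enorm M'.
Proof.
rewrite -big_split ler_sum// => i _; rewrite -big_split ler_sum// => j _.
by rewrite mxE cmodD.
Qed.

Lemma enormZ m n a (M : 'M[R[i]]_(m, n)) : enorm (a *: M) = cmod a * enorm M.
Proof.
rewrite /enorm mulr_sumr; apply: eq_bigr => i _.
by rewrite mulr_sumr; apply: eq_bigr => j _; rewrite mxE cmodM.
Qed.

Lemma enormN m n (M : 'M[R[i]]_(m, n)) : enorm (- M) = enorm M.
Proof. by rewrite -scaleN1r enormZ cmodN cmod1 mul1r. Qed.

Lemma enormB m n (M M' : 'M[R[i]]_(m, n)) : enorm (M - M') <= enorm M + enorm M'.
Proof. by rewrite -[enorm M']enormN enormD. Qed.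

Lemma enormM m n p (M : 'M[R[i]]_(m, n)) (M' : 'M[R[i]]_(n, p)) :
  enorm (M *m M') <= enorm M * enorm M'.
Proof.
rewrite /enorm mulr_suml ler_sum// => i _.
apply: (@le_trans _ _ (\sum_j \sum_k cmod (M i k) * cmod (M' k j))).
  rewrite ler_sum// => j _; rewrite mxE; apply: le_trans (cmod_sum _ _ _) _.
  by rewrite ler_sum// => k _; rewrite cmodM.
rewrite exchange_big mulr_suml ler_sum// => k _ /=.
rewrite -mulr_sumr ler_wpM2l ?cmod_ge0// (bigD1 k)//= lerDl sumr_ge0// => l _.
by rewrite sumr_ge0// => j _; rewrite cmod_ge0.
Qed.

Lemma enorm_rows m n (M : 'M[R[i]]_(m, n)) : enorm M = \sum_i enorm (row i M).
Proof.
apply: eq_bigr => i _; rewrite /enorm big_ord1.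
by apply: eq_bigr => j _; rewrite mxE.
Qed.

(** The entries of the adjugate are polynomials in the entries of the matrix. *)
Lemma enorm_adj_bounded n (b : R) :
  exists G : R, forall M : 'M[R[i]]_n, enorm M <= b -> enorm (\adj M) <= G.
Proof.
exists (\sum_(i < n) \sum_(j < n) \sum_(s : 'S_n.-1) `|b| ^+ n.-1) => M Mb.
rewrite ler_sum// => i _; rewrite ler_sum// => j _.
rewrite mxE /cofactor cmodM cmodX cmodN cmod1 expr1n mul1r /determinant.
apply: le_trans (cmod_sum _ _ _) _; apply: ler_sum => s _.
rewrite cmodM cmodX cmodN cmod1 expr1n mul1r cmod_prod.
apply: le_trans (_ : \prod_(k < n.-1) `|b| <= _); last first.
  by rewrite prodr_const card_ord.
apply: ler_prod => k _; rewrite cmod_ge0 /= !mxE.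
exact: le_trans (cmod_le_enorm _ _ _) (le_trans Mb (ler_norm b)).
Qed.

End EntryNorm.

Section Words.
Variables (R : realType) (E : finType) (n : nat) (A : E -> 'M[R[i]]_n).

Definition word_mx (w : seq E) : 'M[R[i]]_n := \big[mulmx/1%:M]_(e <- w) A e.

Lemma word_nil : word_mx [::] = 1%:M.
Proof. exact: big_nil. Qed.

Lemma word_cons e w : word_mx (e :: w) = A e *m word_mx w.
Proof. exact: big_cons. Qed.

Lemma word_cat u v : word_mx (u ++ v) = word_mx u *m word_mx v.
Proof.
elim: u => [|e u IH] /=; first by rewrite word_nil mul1mx.
by rewrite !word_cons IH mulmxA.
Qed.

Lemma word_rcons w e : word_mx (rcons w e) = word_mx w *m A e.
Proof. by rewrite -cats1 word_cat word_cons word_nil mulmx1. Qed.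

End Words.

(** * Eigenvalues of long words in a bounded family *)

Section Growth.
Variable R : realType.

(** Bernoulli's inequality bounds [r ^+ k] below by [1 + k%:R * (r - 1)]. *)
Lemma expr_unbounded (r B : R) : 1 < r -> exists k, B < r ^+ k.
Proof.
move=> r1; have r10 : 0 < r - 1 by rewrite subr_gt0.
have bern k : 1 + k%:R * (r - 1) <= r ^+ k.
  elim: k => [|k IH]; first by rewrite mul0r addr0 expr0.
  rewrite exprS; apply: le_trans (ler_wpM2l (ltW (lt_trans ltr01 r1)) IH).
  have -> : r * (1 + k%:R * (r - 1)) =
      1 + k.+1%:R * (r - 1) + k%:R * (r - 1) ^+ 2 by rewrite -natr1; ring.
  by rewrite lerDl mulr_ge0 ?sqr_ge0.
exists (Num.truncn (B / (r - 1))).+1; apply: lt_le_trans (bern _).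
rewrite -ltrBlDl; apply: (lt_trans (y := B)); first by rewrite ltrBlDl ltrDr.
by rewrite -ltr_pdivrMr// truncnS_gt.
Qed.

Lemma root_gt1 (x : R) n : 1 < x -> exists2 r, 1 < r & r ^+ n.+1 = x.
Proof.
move=> x1; have x0 := ltW (lt_trans ltr01 x1).
exists (x `^ n.+1%:R^-1); last first.
  by rewrite -powR_mulrn ?powR_ge0// -powRrM mulVf ?powRr1.
have := @gt0_ltr_powR _ (n.+1%:R^-1 : R) _ 1 x.
by rewrite powR1; apply; rewrite ?inE ?nnegrE ?invr_gt0.
Qed.

End Growth.

Section Pigeonhole.
Variable R : realType.

(** Rounding real and imaginary parts of the entries to a grid leaves finitely
    many possible matrices. *)
Lemma bounded_mx_close m n (B d : R) : 0 < d ->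
  exists T : nat, forall P : nat -> 'M[R[i]]_(m, n),
    (forall i, enorm (P i) <= B) ->
    exists i j, [/\ (i < j)%N, (j < T)%N & enorm (P j - P i) <= d].
Proof.
move=> d0; pose D := (m * n).*2.
pose h : R := d / D.+1%:R; have h0 : 0 < h by rewrite divr_gt0.
pose T0 := Num.truncn ((B + B) / h).
pose part (z : R[i]) (b : bool) := if b then complex.Re z else complex.Im z.
have partB z z' b : part (z - z') b = part z b - part z' b.
  by case: z z' b => [a b] [a' b'] [].
have part_le z b : `|part z b| <= cmod z.
  by case: b; [exact: cmod_Re | exact: cmod_Im].
pose q (x : R) : 'I_T0.+1 := inord (Num.truncn ((x + B) / h)).
have q_close x y : `|x| <= B -> `|y| <= B -> q x = q y -> `|x - y| <= h.
  move=> xB yB /(congr1 val); rewrite !ler_norml in xB yB.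
  have trB z : -B <= z <= B -> (Num.truncn ((z + B) / h) < T0.+1)%N.
    move=> /andP[_ zB]; rewrite ltnS le_truncn// ler_pM2r ?invr_gt0//.
    by rewrite lerD2r.
  have nz z : -B <= z <= B -> 0 <= (z + B) / h.
    move=> /andP[zB _]; apply: divr_ge0 (ltW h0).
    by rewrite -[B]opprK subr_ge0.
  rewrite /= !inordK ?trB// => qxy.
  have /andP[x1 x2] := truncn_itv (nz _ xB).
  have /andP[y1 y2] := truncn_itv (nz _ yB).
  rewrite qxy in x1 x2; rewrite -natr1 in x2 y2.
  have -> : x - y = h * ((x + B) / h - (y + B) / h) by field; rewrite gt_eqF.
  rewrite normrM (gtr0_norm h0) ler_piMr ?(ltW h0)// ler_norml; apply/andP.
  by split; lra.
pose F := {ffun 'I_m * 'I_n * bool -> 'I_T0.+1}.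
exists #|F|.+1 => P PB.
pose f (i : 'I_#|F|.+1) : F := [ffun k => q (part (P i k.1.1 k.1.2) k.2)].
have : ~~ injectiveb f.
  apply/negP => /injectiveP/leq_card; by rewrite card_ord ltnn.
move=> /injectivePn[i0 [j0 ne_ij0 fij0]].
have [i [j [ij fij]]] : exists i j : 'I_#|F|.+1, (i < j)%N /\ f i = f j.
  case: (ltngtP i0 j0) => [lt|lt|/val_inj e]; first by exists i0, j0.
    by exists j0, i0.
  by rewrite e eqxx in ne_ij0.
exists i, j; split => //.
apply: (le_trans (y := \sum_(a < m) \sum_(b < n) (h + h))).
  rewrite ler_sum// => a _; rewrite ler_sum// => b _.
  apply: le_trans (cmod_le_ReIm _) _.
  have cl c : `|part (P j a b) c - part (P i a b) c| <= h.
    apply: q_close; try exact: le_trans (part_le _ _)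
      (le_trans (cmod_le_enorm _ _ _) (PB _)).
    by move/ffunP/(_ (a, b, c)): fij; rewrite !ffunE.
  rewrite !mxE lerD//.
    by rewrite -[complex.Re _]/(part _ true) partB cl.
  by rewrite -[complex.Im _]/(part _ false) partB cl.
rewrite !sumr_const !card_ord -mulr2n -!mulrnA -mulr_natr /h mulrAC.
rewrite ler_pdivrMr// ler_pM2l// ler_nat /D -muln2; lia.
Qed.

End Pigeonhole.

Section Eigenvalues.
Variable R : realType.

(** The determinant is the value at 1 of the characteristic polynomial, hence the
    product of the [1 - z] over the eigenvalues [z]. *)
Lemma det_subr1_ge n (Q : 'M[R[i]]_n) (eps : R) : 0 <= eps ->
  (forall z, eigenvalue Q z -> cmod z <= 1 - eps) ->
  eps ^+ n <= cmod (\det (1%:M - Q)).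
Proof.
move=> eps0 Qeps.
have detE : \det (1%:M - Q) = (char_poly Q).[1].
  rewrite -horner_evalE /char_poly -det_map_mx; congr (\det _).
  apply/matrixP => i j; rewrite !mxE -[RHS]/(horner _ 1).
  by rewrite hornerD hornerMn hornerX hornerN hornerC.
have [r Qr] := closed_field_poly_normal (char_poly Q).
rewrite (monicP (char_poly_monic Q)) scale1r in Qr.
have sz : size r = n.
  by have := size_char_poly Q; rewrite Qr size_prod_XsubC => -[].
rewrite detE Qr horner_prod cmod_prod -[in leLHS]sz.
have : forall z, z \in r -> cmod z <= 1 - eps.
  by move=> z zr; apply: Qeps; rewrite eigenvalue_root_char Qr root_prod_XsubC.
elim: {Qr sz} r => [|z r IH] zr; first by rewrite big_nil expr0.
rewrite big_cons exprS ler_pM ?exprn_ge0//; last first.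
  by apply: IH => z' z'r; apply: zr; rewrite inE z'r orbT.
rewrite hornerXsubC; have := zr z (mem_head _ _).
have := cmodD (1 - z) z; rewrite subrK cmod1; lra.
Qed.

Lemma eigenvalue_pow n (M : 'M[R[i]]_n) z (v : 'rV_n) k :
  v *m M = z *: v -> v *m iter k (mulmx M) 1%:M = z ^+ k *: v.
Proof.
move=> vM; elim: k => [|k IH] /=; first by rewrite mulmx1 scale1r.
by rewrite mulmxA vM -scalemxAl IH scalerA exprS.
Qed.

End Eigenvalues.

Section Families.
Variable R : realType.

(** The joint spectral radius of the family is at least 1. *)
Definition nondecaying (E : finType) n (A : E -> 'M[R[i]]_n) :=
  exists2 c : R, 0 < c & forall k, exists2 w, size w = k & c <= enorm (word_mx A w).

(** The joint spectral radius of the family is at most 1. *)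
Definition subexponential (E : finType) n (A : E -> 'M[R[i]]_n) :=
  forall r : R, 1 < r -> exists B, forall w, enorm (word_mx A w) <= B * r ^+ size w.

Definition long_unit_eigenvalues (E : finType) n (A : E -> 'M[R[i]]_n) :=
  forall (eps : R) K, 0 < eps -> exists w z,
    [/\ (K <= size w)%N, eigenvalue (word_mx A w) z & 1 - eps <= cmod z].

(** An eigenvalue of modulus above 1 would make the powers of the word grow
    exponentially. *)
Lemma subexponential_eigenvalue_le1 (E : finType) n (A : E -> 'M[R[i]]_n) w z :
  subexponential A -> eigenvalue (word_mx A w) z -> cmod z <= 1.
Proof.
move=> subA /eigenvalueP[v vM v0]; rewrite leNgt; apply/negP => z1.
have [r r1 rz] := root_gt1 (size w) z1.
have [B AB] := subA r r1.
have [k] := expr_unbounded B r1; apply/negP; rewrite -leNgt.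
have := AB (flatten (nseq k w)).
have -> : word_mx A (flatten (nseq k w)) = iter k (mulmx (word_mx A w)) 1%:M.
  by elim: k => [|k IH] /=; rewrite ?word_nil// word_cat IH.
rewrite size_flatten /shape map_nseq sumn_nseq.
set Mk := iter k _ _ => MkB.
have v0' := enorm_gt0 v0.
have : cmod z ^+ k * enorm v <= enorm v * enorm Mk.
  by rewrite -cmodX -enormZ -(eigenvalue_pow _ vM) enormM.
rewrite mulrC ler_pM2l// => zMk.
have := le_trans zMk MkB.
rewrite -rz -exprM mulSn exprD.
by rewrite ler_pM2r ?exprn_gt0 ?(lt_trans ltr01 r1).
Qed.

(** Among the long prefixes of a word, two are close. The factor [Q] between
    them is bounded and nearly fixes vectors that are not small, which makes
    [\det (1 - Q)] small. *)
Lemma bounded_long_unit_eigenvalues (E : finType) n (A : E -> 'M[R[i]]_n) (B : R) :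
  nondecaying A -> (forall w, enorm (word_mx A w) <= B) ->
  long_unit_eigenvalues A.
Proof.
move=> [c c0 Ac] AB eps K eps0.
have B0 : 0 < B.
  by have [w _ cw] := Ac 0; exact: lt_le_trans c0 (le_trans cw (AB w)).
have [G adjG] := enorm_adj_bounded n (enorm (1%:M : 'M[R[i]]_n) + B).
pose G' := `|G| + 1; have G'0 : 0 < G' by rewrite ltr_wpDl.
pose e := eps / 2; have e0 : 0 < e by rewrite divr_gt0.
(* Small enough to contradict
   [e ^+ n * (c / B) <= cmod (\det (1%:M - Q)) * enorm (P i)]. *)
pose d := e ^+ n * (c / B) / G' / 2.
have d0 : 0 < d by rewrite /d !mulr_gt0 ?invr_gt0 ?exprn_gt0.
have [T PT] := bounded_mx_close n n B d0.
have [u uK cu] := Ac (T * K)%N.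
pose P i := word_mx A (take (i * K) u).
have [i [j [ij jT dij]]] := PT P (fun i => AB _).
pose s := drop (i * K) (take (j * K) u).
have leK : (i * K <= j * K)%N by rewrite leq_mul2r (ltnW ij) orbT.
have Pj : P j = P i *m word_mx A s.
  rewrite /P -word_cat; congr word_mx.
  by rewrite -[LHS](cat_take_drop (i * K)) take_takel.
have Ks : (K <= size s)%N.
  rewrite size_drop size_take uK.
  have jK : (j * K <= T * K)%N by rewrite leq_mul2r (ltnW jT) orbT.
  have -> : (if (j * K < T * K)%N then (j * K)%N else (T * K)%N) = (j * K)%N.
    by case: ltnP => // ?; apply/eqP; rewrite eqn_leq jK andbT.
  by rewrite -mulnBl leq_pmull// subn_gt0.
have Pi : c / B <= enorm (P i).
  rewrite ler_pdivrMr//; apply: le_trans cu _.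
  rewrite -[u](cat_take_drop (i * K)) word_cat.
  by apply: le_trans (enormM _ _) _; rewrite ler_wpM2l ?enorm_ge0.
set Q := word_mx A s in Pj.
have [|noz] := pselect (exists2 z, eigenvalue Q z & 1 - e < cmod z).
  move=> [z Qz ez]; exists s, z; split => //; apply: le_trans (ltW ez).
  by rewrite lerD2l lerN2 /e; lra.
exfalso.
have Qe z : eigenvalue Q z -> cmod z <= 1 - e.
  by move=> Qz; rewrite leNgt; apply/negP => ez; apply: noz; exists z.
have dete := det_subr1_ge (ltW e0) Qe.
(* Multiply [P i *m (1%:M - Q)] by the adjugate of [1%:M - Q]. *)
have : cmod (\det (1%:M - Q)) * enorm (P i) <= d * G'.
  rewrite -enormZ -mul_mx_scalar -mul_mx_adj mulmxA mulmxBr mulmx1 -Pj.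
  apply: le_trans (enormM _ _) _; rewrite ler_pM ?enorm_ge0//.
    by rewrite -enormN opprB.
  apply: le_trans (_ : G <= _); last by rewrite /G' ler_wpDr// ler_norm.
  by apply: adjG; apply: le_trans (enormB _ _) _; rewrite lerD2l AB.
apply/negP; rewrite -ltNge.
have -> : d * G' = e ^+ n * (c / B) / 2 by rewrite /d mulrAC divfK ?gt_eqF.
apply: lt_le_trans (_ : e ^+ n * (c / B) <= _).
  by rewrite ltr_pdivrMr// ltr_pMr ?ltr1n// !mulr_gt0 ?invr_gt0 ?exprn_gt0.
by apply: ler_pM => //; [rewrite exprn_ge0 ?ltW | rewrite divr_ge0 ?ltW].
Qed.

End Families.

(** * Vectors with bounded orbit *)

Section LinearPredicates.
Variable F : fieldType.

(** A linear subspace given by a predicate is the row space of a matrix of maximal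
    rank among those whose row space satisfies the predicate. *)
Lemma linear_pred_rowspace n (P : 'rV[F]_n -> Prop) :
  P 0 -> (forall a u v, P u -> P v -> P (a *: u + v)) ->
  exists V : 'M[F]_n, forall x, (x <= V)%MS <-> P x.
Proof.
move=> P0 Plin.
pose Q (V : 'M[F]_n) := forall x, (x <= V)%MS -> P x.
pose q r := `[< exists2 V : 'M[F]_n, \rank V = r & Q V >].
have exq : exists r, q r.
  by exists 0%N; apply/asboolP; exists 0 => [|x /submx0null->//]; rewrite mxrank0.
have qn r : q r -> (r <= n)%N by move=> /asboolP[V <- _]; rewrite rank_leq_row.
have [r /asboolP[V rV QV] rmax] := ex_maxnP exq qn.
exists V => x; split => [/QV//|Px].
have QVx : Q (V + x)%MS.
  move=> y /sub_addsmxP[[u w] ->] /=; rewrite addrC [w]mx11_scalar mul_scalar_mx.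
  by apply: Plin => //; apply: QV; rewrite submxMl.
have VVx : (V <= V + x)%MS by rewrite addsmxSl.
have : \rank (V + x)%MS = \rank V.
  apply/eqP; rewrite eqn_leq (mxrankS VVx) rV andbT.
  by apply: rmax; apply/asboolP; exists (V + x)%MS.
move=> rVx; apply: submx_trans (addsmxSr V x) _.
by have [_ <-] := mxrank_leqif_sup VVx; rewrite rVx.
Qed.

Lemma eigenvalue_tr n (M : 'M[F]_n) z : eigenvalue M^T z = eigenvalue M z.
Proof.
rewrite /eigenvalue /eigenspace !kermx_eq0 /row_free -mxrank_tr.
by rewrite linearB /= trmxK tr_scalar_mx.
Qed.

End LinearPredicates.

Section Compactness.
Variable R : realType.

(** An ultrafilter makes all coordinates converge along the same indices, without
    successive extraction of subsequences. *)
Lemma bounded_ultra_cvg (U : set_system nat) (f : nat -> R) (B : R) :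
  UltraFilter U -> (forall k, `|f k| <= B) ->
  exists l, forall e, 0 < e -> U [set k | `|f k - l| < e].
Proof.
move=> UU fB; have PU := ultra_proper (F := U).
have [] := @segment_compact R (- B) B (f @ U) _.
  by apply: (@filterE _ U) => k /=; rewrite in_itv /= -ler_norml.
move=> l [_ cl]; exists l => e e0.
have [//|] := in_ultra_setVsetC [set k | `|f k - l| < e] UU.
move=> Ue; have [y [/= ye ly]] := cl [set y | ~ `|y - l| < e] (ball l e) Ue
  (nbhsx_ballx l e e0).
by case: ye; rewrite distrC.
Qed.

Lemma bounded_rV_cluster n (u : nat -> 'rV[R[i]]_n) (B : R) :
  (forall k, enorm (u k) <= B) ->
  exists x, forall (e : R) K, 0 < e -> exists2 k, (K <= k)%N & enorm (u k - x) <= e.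
Proof.
move=> uB; have [U [UU ooU]] := @ultraFilterLemma nat \oo _.
have PU := ultra_proper (F := U).
have part_cvg (f : R[i] -> R) : (forall z, `|f z| <= cmod z) ->
    exists l : 'I_n -> R,
      forall i e, 0 < e -> U [set k | `|f (u k 0 i) - l i| < e].
  move=> fc; have /choice[l lP] (i : 'I_n) : exists l : R,
      forall e, 0 < e -> U [set k | `|f (u k 0 i) - l| < e].
    apply: (@bounded_ultra_cvg _ _ B) => k.
    exact: le_trans (fc _) (le_trans (cmod_le_enorm _ _ _) (uB k)).
  by exists l.
have [a ua] := part_cvg _ (@cmod_Re R).
have [b ub] := part_cvg _ (@cmod_Im R).
exists (\row_i (a i +i* b i)%C) => e K e0.
pose h := e / n.*2.+1%:R; have h0 : 0 < h by rewrite divr_gt0.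
have : U [set k | (K <= k)%N /\ forall i,
    `|complex.Re (u k 0 i) - a i| < h /\ `|complex.Im (u k 0 i) - b i| < h].
  apply: filterI; first by apply: ooU; exists K.
  by apply: filter_forall => i; apply: filterI; [exact: ua | exact: ub].
move=> /filter_ex[k [Kk kh]]; exists k => //.
apply: (le_trans (y := \sum_(i < 1) \sum_(j < n) (h + h))).
  rewrite ler_sum// => i _; rewrite ler_sum// => j _; rewrite ord1.
  apply: le_trans (cmod_le_ReIm _) _; have [ha hb] := kh j.
  by rewrite !mxE; move: ha hb; case: (u k 0 j) => c d /= ? ?; rewrite lerD ?ltW.
rewrite !sumr_const !card_ord -mulr2n -!mulrnA -mulr_natr /h mulrAC.
by rewrite ler_pdivrMr// ler_pM2l// ler_nat; lia.
Qed.

End Compactness.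

Section Reduction.
Variable R : realType.
Variables (E : finType) (n : nat) (A : E -> 'M[R[i]]_n).

Definition bounded_orbit (x : 'rV[R[i]]_n) :=
  exists B, forall w, enorm (x *m word_mx A w) <= B.

Lemma bounded_orbit_rowspace :
  exists V : 'M[R[i]]_n, forall x, (x <= V)%MS <-> bounded_orbit x.
Proof.
apply: linear_pred_rowspace.
  by exists 0 => w; rewrite mul0mx enorm0.
move=> a u v [B Bu] [B' Bv]; exists (cmod a * B + B') => w.
rewrite mulmxDl -scalemxAl; apply: le_trans (enormD _ _) _.
by rewrite lerD// enormZ ler_wpM2l ?cmod_ge0.
Qed.

Lemma bounded_orbit_stable (V : 'M[R[i]]_n) e :
  (forall x, (x <= V)%MS <-> bounded_orbit x) -> (V *m A e <= V)%MS.
Proof.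
move=> VP; apply/row_subP => i; rewrite row_mul; apply/VP.
have /VP[B vB] : (row i V <= V)%MS := row_sub i V.
by exists B => w; rewrite -mulmxA -word_cons.
Qed.

Lemma full_bounded_orbit (V : 'M[R[i]]_n) :
  (forall x, (x <= V)%MS <-> bounded_orbit x) -> row_full V ->
  exists B, forall w, enorm (word_mx A w) <= B.
Proof.
move=> VP Vfull.
have /choice[B Bw] (i : 'I_n) : exists B : R, forall w,
    enorm ((delta_mx 0 i : 'rV_n) *m word_mx A w) <= B.
  by apply/VP; rewrite submx_full.
exists (\sum_i B i) => w; rewrite enorm_rows ler_sum// => i _.
by rewrite rowE.
Qed.

(** Unit vectors that no word of length at most [L] doubles, one for each [L],
    would cluster at a nonzero vector with bounded orbit. *)
Lemma no_bounded_orbit_doubling :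
  (forall x, bounded_orbit x -> x = 0) ->
  exists L, forall x : 'rV[R[i]]_n, exists2 w,
    (size w <= L)%N & 2 * enorm x <= enorm (x *m word_mx A w).
Proof.
move=> nob; apply: contrapT => noL.
have /choice[u uP] (L : nat) : exists x : 'rV[R[i]]_n, enorm x = 1 /\
    forall w, (size w <= L)%N -> enorm (x *m word_mx A w) <= 2.
  apply: contrapT => nox; apply: noL; exists L => x.
  apply: contrapT => now; apply: nox.
  have xw w : (size w <= L)%N -> enorm (x *m word_mx A w) < 2 * enorm x.
    by move=> wL; rewrite ltNge; apply/negP => xw; apply: now; exists w.
  have x0 : 0 < enorm x.
    by have := le_lt_trans (enorm_ge0 _) (xw [::] (leq0n L)); lra.
  have xV : cmod (enorm x)^-1%:C%C = (enorm x)^-1.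
    by rewrite cmod_real ger0_norm ?invr_ge0 ?enorm_ge0.
  exists ((enorm x)^-1%:C%C *: x); split.
    by rewrite enormZ xV mulVf ?gt_eqF.
  move=> w wL; rewrite -scalemxAl enormZ xV.
  by rewrite ler_pdivrMl// mulrC ltW ?xw.
have [|x xP] := @bounded_rV_cluster R n u 1.
  by move=> k; have [->] := uP k.
suff x0 : x = 0.
  have half_gt0 : (0 : R) < 2^-1 by rewrite invr_gt0 ltr0n.
  have [k _] := xP (2^-1) 0%N half_gt0.
  by rewrite x0 subr0 (uP k).1; lra.
apply: nob; exists 3 => w; have Nw := enorm_ge0 (word_mx A w).
have [|k kw] := xP (1 + enorm (word_mx A w))^-1 (size w).
  by rewrite invr_gt0; lra.
move=> ux; rewrite -[x](subrK (u k)) mulmxDl; apply: le_trans (enormD _ _) _.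
have -> : 3 = 1 + 2 :> R by lra.
apply: lerD; last exact: (uP k).2.
apply: le_trans (enormM _ _) _; rewrite -enormN opprB.
apply: le_trans (ler_wpM2r Nw ux) _.
by rewrite mulrC ler_pdivrMr ?mul1r; lra.
Qed.

(** Iterating the doubling of a vector multiplies its norm by [2 ^+ k] with a word
    of length at most [k * L], which is exponential growth. *)
Lemma exists_bounded_orbit : (0 < n)%N -> subexponential A ->
  exists2 x, bounded_orbit x & x != 0.
Proof.
move=> n0 subA; apply: contrapT => nox.
have [|L LP] := no_bounded_orbit_doubling.
  by move=> x xb; apply/eqP/negP => /negP x0; apply: nox; exists x.
pose x : 'rV[R[i]]_n := const_mx 1.
have x0 : 0 < enorm x.
  apply: enorm_gt0; apply/eqP => /rowP/(_ (Ordinal n0))/eqP.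
  by rewrite !mxE oner_eq0.
have grow k : exists2 w,
    (size w <= k * L)%N & 2 ^+ k * enorm x <= enorm (x *m word_mx A w).
  elim: k => [|k [w wk xw]].
    by exists [::] => //; rewrite word_nil mulmx1 mul1r.
  have [v vL xv] := LP (x *m word_mx A w).
  exists (w ++ v); first by rewrite size_cat mulSn addnC leq_add.
  rewrite word_cat mulmxA; apply: le_trans xv.
  by rewrite exprS -mulrA ler_pM2l.
(* With [r ^+ L.+1 = 2], the bound [r ^+ (k * L)] misses [2 ^+ k] by [r ^+ k]. *)
have [r r1 r2] := @root_gt1 R 2 L (ltr1n R 2).
have [B AB] := subA r r1.
have [k] := expr_unbounded (`|B|) r1; apply/negP; rewrite -leNgt.
have [w wk xw] := grow k.
have : 2 ^+ k * enorm x <= enorm x * (`|B| * r ^+ (k * L)).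
  apply: le_trans xw _; apply: le_trans (enormM _ _) _.
  rewrite ler_pM2l//; apply: le_trans (AB w) _.
  apply: le_trans (_ : `|B| * r ^+ size w <= _).
    by rewrite ler_wpM2r ?ler_norm// exprn_ge0// ltW// (lt_trans ltr01 r1).
  by rewrite ler_wpM2l// ler_weXn2l// ltW.
rewrite mulrC ler_pM2l// -r2 -exprM mulSn exprD mulnC ler_pM2r//.
by rewrite exprn_gt0 ?(lt_trans ltr01 r1).
Qed.

End Reduction.

(** * Block triangular families *)

Section Submultiplicative.
Variables (R : realType) (E : finType).

Lemma submult_decay (f : seq E -> R) (c : R) k m w :
  (forall w, 0 <= f w) -> (forall u v, f (u ++ v) <= f u * f v) ->
  (forall w, size w = k -> f w <= c) -> size w = (m.+1 * k)%N ->
  f w <= c ^+ m.+1.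
Proof.
move=> f0 fM fc; elim: m w => [|m IH] w; rewrite mulSn => wk.
  by rewrite expr1 fc// wk addn0.
rewrite -[w](cat_take_drop k) exprS; apply: le_trans (fM _ _) _.
apply: ler_pM => //.
  by rewrite fc// size_takel// wk leq_addr.
by rewrite IH// size_drop wk addKn.
Qed.

Lemma not_nondecaying_small n (A : E -> 'M[R[i]]_n) (c : R) :
  ~ nondecaying A -> 0 < c ->
  exists k, forall w, size w = k -> enorm (word_mx A w) <= c.
Proof.
move=> notA c0; apply: contrapT => nok; apply: notA; exists c => // k.
apply: contrapT => now; apply: nok; exists k => w wk.
by rewrite leNgt; apply/negP => /ltW cw; apply: now; exists w.
Qed.

Lemma enorm_word_catM n (A : E -> 'M[R[i]]_n) u v :
  enorm (word_mx A (u ++ v)) <= enorm (word_mx A u) * enorm (word_mx A v).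
Proof. by rewrite word_cat enormM. Qed.

Lemma enorm1_ge1 n : (0 < n)%N -> 1 <= enorm (1%:M : 'M[R[i]]_n).
Proof.
case: n => // n _; rewrite -(cmod1 R).
by apply: le_trans (cmod_le_enorm _ ord0 ord0); rewrite mxE eqxx.
Qed.

End Submultiplicative.

(** In the basis given by the rows of [B1] and [B2], whose inverse has the column
    blocks [C1] and [C2], every [A e] is block triangular: [subblock] acts on the
    invariant row space of [B1], and [quoblock] on the quotient by it. *)
Section Blocks.
Variables (R : realType) (E : finType) (n p q : nat) (A : E -> 'M[R[i]]_n).
Variables (B1 : 'M[R[i]]_(p, n)) (C1 : 'M[R[i]]_(n, p)).
Variables (B2 : 'M[R[i]]_(q, n)) (C2 : 'M[R[i]]_(n, q)).
Hypothesis CB : C1 *m B1 + C2 *m B2 = 1%:M.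
Hypothesis BC1 : B1 *m C1 = 1%:M.
Hypothesis BC2 : B2 *m C2 = 1%:M.
Hypothesis BC12 : B1 *m C2 = 0.
Hypothesis stable : forall e, B1 *m A e *m C2 = 0.

Definition subblock e := B1 *m A e *m C1.
Definition quoblock e := B2 *m A e *m C2.

Let split_mulA a b (M : 'M[R[i]]_(a, n)) (M' : 'M[R[i]]_(n, b)) :
  M *m M' = M *m C1 *m (B1 *m M') + M *m C2 *m (B2 *m M').
Proof. by rewrite !mulmxA -mulmxDl -!(mulmxA M) -mulmxDr CB mulmx1. Qed.

Lemma word_stable w : B1 *m word_mx A w *m C2 = 0.
Proof.
elim: w => [|e w IH]; first by rewrite word_nil mulmx1.
rewrite word_cons mulmxA -mulmxA split_mulA stable mul0mx addr0.
by rewrite [B1 *m (_ *m _)]mulmxA IH mulmx0.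
Qed.

Lemma word_subblock w : word_mx subblock w = B1 *m word_mx A w *m C1.
Proof.
elim: w => [|e w IH]; first by rewrite !word_nil mulmx1 BC1.
rewrite !word_cons IH (mulmxA B1 (A e)) -(mulmxA (B1 *m A e)).
by rewrite [in RHS]split_mulA stable mul0mx addr0 !mulmxA.
Qed.

Lemma word_quoblock w : word_mx quoblock w = B2 *m word_mx A w *m C2.
Proof.
elim: w => [|e w IH]; first by rewrite !word_nil mulmx1 BC2.
rewrite !word_cons IH (mulmxA B2 (A e)) -(mulmxA (B2 *m A e)).
by rewrite [in RHS]split_mulA [B1 *m (_ *m _)]mulmxA word_stable mulmx0 add0r !mulmxA.
Qed.

Lemma subexponential_conj m (X : E -> 'M[R[i]]_m) (B : 'M[R[i]]_(m, n))
    (C : 'M[R[i]]_(n, m)) :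
  (forall w, word_mx X w = B *m word_mx A w *m C) ->
  subexponential A -> subexponential X.
Proof.
move=> XE subA r r1; have [b Ab] := subA r r1.
exists (enorm B * b * enorm C) => w; rewrite XE mulrAC.
apply: le_trans (enormM _ _) _; rewrite ler_wpM2r ?enorm_ge0//.
apply: le_trans (enormM _ _) _; rewrite -mulrA ler_wpM2l ?enorm_ge0//.
Qed.

Lemma eigenvalue_subblock w z :
  eigenvalue (word_mx subblock w) z -> eigenvalue (word_mx A w) z.
Proof.
move=> /eigenvalueP[v vX v0]; apply/eigenvalueP; exists (v *m B1).
  rewrite -mulmxA [_ *m word_mx A w in LHS](_ : _ = word_mx subblock w *m B1).
    by rewrite mulmxA vX scalemxAl.
  rewrite -[B1 *m _]mulmx1 split_mulA word_stable mul0mx addr0.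
  by rewrite word_subblock mulmx1.
apply: contra v0 => /eqP vB; rewrite -[v]mulmx1 -BC1 mulmxA vB mul0mx//.
Qed.

Lemma eigenvalue_quoblock w z :
  eigenvalue (word_mx quoblock w) z -> eigenvalue (word_mx A w) z.
Proof.
rewrite -eigenvalue_tr => /eigenvalueP[v vZ v0].
rewrite -eigenvalue_tr; apply/eigenvalueP; exists (v *m C2^T).
  rewrite -mulmxA -trmx_mul (_ : word_mx A w *m C2 = C2 *m word_mx quoblock w).
    by rewrite trmx_mul mulmxA vZ scalemxAl.
  rewrite -[word_mx A w *m C2]mul1mx split_mulA !mul1mx.
  rewrite [B1 *m (_ *m _)]mulmxA word_stable.
  by rewrite mulmx0 add0r word_quoblock !mulmxA.
apply: contra v0 => /eqP vC; rewrite -[v]mulmx1 -trmx1 -BC2 trmx_mul mulmxA vC.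
by rewrite mul0mx.
Qed.

(** If both diagonal families had arbitrarily small words, then at a common
    multiple of the two lengths both would contract. Rescaling the off-diagonal
    block by a small [t] keeps the norm submultiplicative and makes the whole
    family contract at that length. *)
Lemma nondecaying_block : (0 < p)%N -> (0 < q)%N ->
  subexponential A -> nondecaying A -> nondecaying subblock \/ nondecaying quoblock.
Proof.
move=> p0 q0 subA [c c0 Ac]; apply: contrapT => /not_orP[nX nZ].
have q4 : (0 : R) < 4^-1 by rewrite invr_gt0 ltr0n.
have [k1 Xk1] := not_nondecaying_small nX q4.
have [k2 Zk2] := not_nondecaying_small nZ q4.
have pos m (M : E -> 'M[R[i]]_m) k : (0 < m)%N ->
    (forall w, size w = k -> enorm (word_mx M w) <= 4^-1) -> (0 < k)%N.
  move=> m0 Mk; case: k Mk => // /(_ [::] erefl); rewrite word_nil.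
  by have := enorm1_ge1 R m0; lra.
have k10 := pos _ _ _ p0 Xk1; have k20 := pos _ _ _ q0 Zk2.
(* Replacing [k] by a multiple [l * k] keeps the words small. *)
have small m (M : E -> 'M[R[i]]_m) k l w : (0 < l)%N ->
    (forall w, size w = k -> enorm (word_mx M w) <= 4^-1) ->
    size w = (l * k)%N -> enorm (word_mx M w) <= 4^-1.
  case: l => // l _ Mk wlk.
  apply: le_trans (submult_decay (fun w => enorm_ge0 _) (enorm_word_catM M) Mk wlk) _.
  by rewrite exprS ler_piMr ?(ltW q4)// exprn_ile1 ?(ltW q4)//; lra.
pose k := (k1 * k2)%N.
have Xk w : size w = k -> enorm (word_mx subblock w) <= 4^-1.
  by rewrite /k mulnC; exact: small.
have Zk w : size w = k -> enorm (word_mx quoblock w) <= 4^-1.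
  by apply: small.
have [b Ab] := subA 2 (ltr1n R 2).
pose Y w := B2 *m word_mx A w *m C1.
pose T := `|enorm B2 * (b * 2 ^+ k) * enorm C1| + 1.
have T0 : 0 < T by rewrite ltr_wpDl.
have YT w : size w = k -> enorm (Y w) <= T.
  move=> wk; apply: le_trans (_ : enorm B2 * (b * 2 ^+ k) * enorm C1 <= _).
    apply: le_trans (enormM _ _) _; rewrite ler_wpM2r ?enorm_ge0//.
    apply: le_trans (enormM _ _) _; rewrite ler_wpM2l ?enorm_ge0//.
    by rewrite -wk.
  by rewrite /T ler_wpDr// ler_norm.
pose t := (4 * T)^-1; have t0 : 0 < t by rewrite invr_gt0 mulr_gt0.
pose N w := enorm (word_mx subblock w) + enorm (word_mx quoblock w) + t * enorm (Y w).
have N0 w : 0 <= N w by rewrite !addr_ge0 ?mulr_ge0 ?enorm_ge0// ltW.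
have Ycat u v : Y (u ++ v) =
    Y u *m word_mx subblock v + word_mx quoblock u *m Y v.
  rewrite /Y word_cat mulmxA -(mulmxA _ _ C1) split_mulA.
  by rewrite word_subblock word_quoblock !mulmxA.
have NM u v : N (u ++ v) <= N u * N v.
  have key (a z y a' z' y' : R) : 0 <= a -> 0 <= z -> 0 <= y ->
      0 <= a' -> 0 <= z' -> 0 <= y' ->
      a * a' + z * z' + (y * a' + z * y') <= (a + z + y) * (a' + z' + y').
    move=> *; rewrite -subr_ge0.
    rewrite [leRHS](_ : _ = a * (z' + y') + z * a' + y * (z' + y')); last by ring.
    by rewrite !addr_ge0 ?mulr_ge0 ?addr_ge0.
  have t0' := ltW t0; apply: le_trans (key _ _ _ _ _ _ _ _ _ _ _ _);
    rewrite ?mulr_ge0 ?enorm_ge0//.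
  apply: lerD; first by apply: lerD; exact: enorm_word_catM.
  rewrite Ycat -[t * _ * _]mulrA [_ * (t * _)]mulrCA -mulrDr ler_wpM2l//.
  exact: le_trans (enormD _ _) (lerD (enormM _ _) (enormM _ _)).
have Nk w : size w = k -> N w <= 3 / 4.
  move=> wk; have := Xk w wk; have := Zk w wk.
  have : t * enorm (Y w) <= 4^-1.
    by rewrite /t invfM -mulrA ler_piMr ?(ltW q4)// ler_pdivrMl// mulr1 YT.
  by rewrite /N; lra.
pose G := enorm C1 * enorm B1 + enorm C2 * enorm B2 + enorm C2 * enorm B1 / t.
(* The norm of the word is recovered from its blocks in the new basis. *)
have AN w : enorm (word_mx A w) <= G * N w.
  have -> : word_mx A w = C1 *m word_mx subblock w *m B1
      + C2 *m Y w *m B1 + C2 *m word_mx quoblock w *m B2.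
    rewrite word_subblock word_quoblock /Y -[LHS]mul1mx split_mulA !mul1mx.
    rewrite -[B1 *m _ in LHS]mulmx1 -[B2 *m _ in LHS]mulmx1.
    rewrite split_mulA [X in _ + _ *m X]split_mulA !mulmx1 word_stable.
    by rewrite mul0mx addr0 mulmxDr !mulmxA addrA.
  have e3 a b1 d (M1 : 'M[R[i]]_(n, a)) (M2 : 'M[R[i]]_(a, b1)) (M3 : 'M[R[i]]_(b1, d)) :
      enorm (M1 *m M2 *m M3) <= enorm M1 * enorm M3 * enorm M2.
    by rewrite mulrAC; apply: le_trans (enormM _ _) _;
      rewrite ler_wpM2r ?enorm_ge0// enormM.
  apply: le_trans (enormD _ _) _.
  apply: le_trans (lerD (le_trans (enormD _ _) (lerD (e3 _ _ _ _ _ _) (e3 _ _ _ _ _ _)))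
    (e3 _ _ _ _ _ _)) _.
  rewrite /G /N.
  have -> : enorm C2 * enorm B1 * enorm (Y w) =
      (enorm C2 * enorm B1 / t) * (t * enorm (Y w)).
    by rewrite mulrA divfK// gt_eqF.
  have key (x1 x2 x3 y1 y2 y3 : R) : 0 <= x1 -> 0 <= x2 -> 0 <= x3 ->
      0 <= y1 -> 0 <= y2 -> 0 <= y3 ->
      x1 * y1 + x3 * y3 + x2 * y2 <= (x1 + x2 + x3) * (y1 + y2 + y3).
    move=> x10 x20 x30 y10 y20 y30.
    rewrite -addrA [_ + x2 * y2]addrC addrA !mulrDl !lerD// ler_wpM2l//; lra.
  by apply: key; rewrite ?divr_ge0 ?mulr_ge0 ?enorm_ge0 ?(ltW t0).
have [|m] := @expr_unbounded R (4 / 3) (G / c).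
  by rewrite ltr_pdivlMr//; lra.
apply/negP; rewrite -leNgt ler_pdivlMr//.
have [w wk cw] := Ac (m.+1 * k)%N.
have := submult_decay N0 NM Nk wk.
have G0 : 0 <= G.
  by rewrite !addr_ge0 ?divr_ge0 ?mulr_ge0 ?enorm_ge0 ?(ltW t0).
move=> /(ler_wpM2l G0)/(le_trans (AN w))/(le_trans cw) {}cw.
have -> : (4 / 3 : R) ^+ m = ((3 / 4) ^+ m)^-1 by rewrite -exprVn invf_div.
have m0 : 0 < (3 / 4 : R) ^+ m by rewrite exprn_gt0 ?divr_gt0.
rewrite ler_pdivrMl//; apply: le_trans cw _.
by rewrite exprS; have := mulr_ge0 (ltW m0) G0; lra.
Qed.

End Blocks.

(** * Long words with an eigenvalue of modulus close to 1 *)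

Section Core.
Variable R : realType.

Lemma complement_blocks (F : fieldType) n p q
    (B1 : 'M[F]_(p, n)) (B2 : 'M[F]_(q, n)) :
  row_free B1 -> row_free B2 -> row_full (B1 + B2)%MS -> (B1 :&: B2 = 0)%MS ->
  exists C1 C2, [/\ C1 *m B1 + C2 *m B2 = 1%:M,
    B1 *m C1 = 1%:M, B2 *m C2 = 1%:M & B1 *m C2 = 0].
Proof.
move=> free1 free2 full12 cap12.
have : (1%:M <= B1 + B2)%MS by rewrite submx_full.
move=> /sub_addsmxP[[C1 C2] /= CB].
have cap0 r (M : 'M[F]_(r, n)) : (M <= B1)%MS -> (M <= B2)%MS -> M = 0.
  by move=> M1 M2; apply/eqP; rewrite -submx0 -cap12 sub_capmx M1.
have B1eq : B1 - B1 *m C1 *m B1 = B1 *m C2 *m B2.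
  by rewrite -!mulmxA -{1}[B1]mulmx1 CB mulmxDr addrAC subrr add0r.
have B2eq : B2 - B2 *m C2 *m B2 = B2 *m C1 *m B1.
  by rewrite -!mulmxA -{1}[B2]mulmx1 CB mulmxDr addrK.
have sub0 r r' (M : 'M[F]_(r, r')) (B : 'M[F]_(r', n)) :
    row_free B -> M *m B = 0 -> M = 0.
  by move=> Bfree /eqP; rewrite mulmx_free_eq0// => /eqP.
have zero1 : B1 *m C2 *m B2 = 0.
  apply: cap0; last exact: submxMl.
  by rewrite -B1eq addmx_sub// -mulNmx ?submxMl.
have zero2 : B2 *m C1 *m B1 = 0.
  apply: cap0; first exact: submxMl.
  by rewrite -B2eq addmx_sub// -mulNmx ?submxMl.
exists C1, C2; split => //.
- apply/eqP; rewrite eq_sym -subr_eq0; apply/eqP; apply: sub0 free1 _.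
  by rewrite mulmxBl mul1mx B1eq zero1.
- apply/eqP; rewrite eq_sym -subr_eq0; apply/eqP; apply: sub0 free2 _.
  by rewrite mulmxBl mul1mx B2eq zero2.
- exact: sub0 free2 zero1.
Qed.

(** The vectors with bounded orbit form an invariant subspace, which is not zero.
    If it is proper, the family is block triangular and one of the diagonal
    blocks is still non-decaying, so induction on the dimension applies. *)
Lemma nondecaying_long_unit_eigenvalues (E : finType) n (A : E -> 'M[R[i]]_n) :
  nondecaying A -> subexponential A -> long_unit_eigenvalues A.
Proof.
have [m] := ubnP n; elim: m => // m IH in n A * => nm ndA subA.
have [V VP] := bounded_orbit_rowspace A.
have [Vfull|Vprop] := boolP (row_full V).
  have [B AB] := full_bounded_orbit VP Vfull.
  exact: bounded_long_unit_eigenvalues ndA AB.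
have rVn : (\rank V < n)%N.
  by rewrite ltn_neqAle rank_leq_row andbT.
have [x /VP xV x0] := exists_bounded_orbit (leq_ltn_trans (leq0n _) rVn) subA.
have rV0 : (0 < \rank V)%N.
  by rewrite lt0n mxrank_eq0; apply: contra x0 => /eqP V0; rewrite V0 submx0 in xV.
have rVC : \rank (V^C)%MS = (n - \rank V)%N by rewrite mxrank_compl.
have [||||C1 [C2 [CB BC1 BC2 BC12]]] :=
    @complement_blocks _ n _ _ (row_base V) (row_base (V^C)%MS).
- exact: row_base_free.
- exact: row_base_free.
- rewrite -sub1mx (adds_eqmx (eq_row_base V) (eq_row_base (V^C)%MS)) sub1mx.
  exact: addsmx_compl_full.
- apply/eqP; rewrite -submx0 (cap_eqmx (eq_row_base V) (eq_row_base (V^C)%MS)).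
  by rewrite submx0 capmx_compl.
set B1 := row_base V in CB BC1 BC12; set B2 := row_base _ in CB BC2.
have stable e : B1 *m A e *m C2 = 0.
  have : (B1 *m A e <= B1)%MS.
    rewrite (eqmxMr _ (eq_row_base V)) eq_row_base.
    exact: bounded_orbit_stable VP.
  by move=> /submxP[D ->]; rewrite -mulmxA BC12 mulmx0.
have [||ndX|ndZ] := nondecaying_block CB BC1 BC2 BC12 stable _ _ subA ndA.
- by [].
- by rewrite rVC subn_gt0.
- have subX := subexponential_conj (word_subblock CB BC1 stable) subA.
  have rVm : (\rank V < m)%N by apply: leq_trans rVn _.
  move=> eps K eps0; have [w [z [wK wz ez]]] := IH _ _ rVm ndX subX eps K eps0.
  by exists w, z; split => //; exact: (eigenvalue_subblock CB BC1 BC12 stable) wz.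
- have subZ := subexponential_conj (word_quoblock CB BC2 BC12 stable) subA.
  have rVm : (\rank (V^C)%MS < m)%N.
    by rewrite rVC; apply: leq_trans (_ : n <= m)%N; rewrite ?ltn_subrL ?rV0//
      (leq_ltn_trans _ rVn).
  move=> eps K eps0; have [w [z [wK wz ez]]] := IH _ _ rVm ndZ subZ eps K eps0.
  by exists w, z; split => //; exact: (eigenvalue_quoblock CB BC2 BC12 stable) wz.
Qed.

End Core.

(** * Coordinates and equivalence of norms *)

Import passmx.

Section Scalars.
Variables (R : realType) (s : scalars).

Lemma to_complex_is_zmod_morphism : zmod_morphism (@to_complex R s).
Proof. by case: s => x y //=; rewrite rmorphB. Qed.

Lemma to_complex_is_monoid_morphism : monoid_morphism (@to_complex R s).
Proof. by case: s; split => //= x y; rewrite rmorphM. Qed.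

HB.instance Definition _ := GRing.isZmodMorphism.Build _ _ (@to_complex R s)
  to_complex_is_zmod_morphism.
HB.instance Definition _ := GRing.isMonoidMorphism.Build _ _ (@to_complex R s)
  to_complex_is_monoid_morphism.

Definition of_real (r : R) : Defs.scalar R s :=
  match s with RealScalars => r | ComplexScalars => r%:C%C end.

Lemma to_complex_of_real r : to_complex (of_real r) = r%:C%C.
Proof. by rewrite /of_real /to_complex; case: s. Qed.

(** The nearest scalar, used to bring a limit of coordinate vectors back into the
    field of scalars. *)
Definition of_complex (z : R[i]) : Defs.scalar R s :=
  match s with RealScalars => complex.Re z | ComplexScalars => z end.

Lemma cmod_of_complex a z :
  cmod (to_complex (a - of_complex z)) <= cmod (to_complex a - z).
Proof.
rewrite /of_complex /to_complex; case: s a => //= a.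
by case: z => b c; have := cmod_Re (a%:C%C - (b +i* c)%C); rewrite -cmod_real.
Qed.

End Scalars.

Section Coordinates.
Variables (R : realType) (s : scalars).
Local Notation K := (Defs.scalar R s).
Implicit Types U V W : vectType K.

Definition coordv V (x : V) : 'rV[R[i]]_(\dim {:V}) :=
  map_mx (@to_complex R s) (rVof (vbasis {:V}) x).

Definition coordm U V (f : 'Hom(U, V)) : 'M[R[i]]_(\dim {:U}, \dim {:V}) :=
  map_mx (@to_complex R s) (mxof (vbasis {:U}) (vbasis {:V}) f).

Lemma coordvZ V a (x : V) : coordv (a *: x) = to_complex a *: coordv x.
Proof. by rewrite /coordv linearZ map_mxZ. Qed.

Lemma coordv_app U V (f : 'Hom(U, V)) x : coordv (f x) = coordv x *m coordm f.
Proof. by rewrite /coordv (@rVof_app _ _ _ _ (vbasis {:V}) (vbasisP _)) map_mxM. Qed.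

Lemma coordm_comp U V W (f : 'Hom(U, V)) (g : 'Hom(V, W)) :
  coordm (g \o f)%VF = coordm f *m coordm g.
Proof. by rewrite /coordm (@mxof_comp _ _ _ _ _ (vbasis {:V}) _ (vbasisP _)) map_mxM. Qed.

Lemma coordm1 V : coordm (\1%VF : 'End(V)) = 1%:M.
Proof. by rewrite /coordm mxof1 ?map_mx1// (basis_free (vbasisP _)). Qed.

Lemma coordv_basis V (i : 'I_(\dim {:V})) : coordv (vbasis {:V})`_i = delta_mx 0 i.
Proof. by rewrite /coordv rVofE ?vbasisP// map_delta_mx. Qed.

Variables (V : vectType K) (Nv : V -> R).
Hypothesis NvP : is_norm Nv.

Lemma is_norm0 : Nv 0 = 0.
Proof. by rewrite -(scale0r (0 : V)) (norm_scale NvP) rmorph0 cmod0 mul0r. Qed.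

Lemma is_normN x : Nv (- x) = Nv x.
Proof. by rewrite -scaleN1r (norm_scale NvP) rmorphN rmorph1 cmodN cmod1 mul1r. Qed.

Lemma is_norm_ge0 x : 0 <= Nv x.
Proof. by have := norm_triangle NvP x (- x); rewrite subrr is_norm0 is_normN; lra. Qed.

Lemma is_norm_le_coord : exists2 C, 0 <= C & forall x, Nv x <= C * enorm (coordv x).
Proof.
exists (\sum_(i < \dim {:V}) Nv (vbasis {:V})`_i).
  by rewrite sumr_ge0// => i _; exact: is_norm_ge0.
move=> x; rewrite {1}[x](coord_vbasis (memvf x)) mulr_suml.
apply: (big_ind2 (fun x y => Nv x <= y)).
- by rewrite is_norm0.
- by move=> a b c d ab cd; apply: le_trans (norm_triangle NvP _ _) (lerD ab cd).
move=> i _; rewrite (norm_scale NvP) mulrC ler_wpM2l ?is_norm_ge0//.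
by apply: le_trans (cmod_le_enorm _ 0 i); rewrite !mxE.
Qed.

(** A sequence of vectors of coordinate norm 1 whose norm tends to 0 would
    cluster at a vector of norm 0. *)
Lemma coord_le_is_norm : exists2 C, 0 <= C & forall x, enorm (coordv x) <= C * Nv x.
Proof.
apply: contrapT => noC; have [C C0 NC] := is_norm_le_coord.
have /choice[u uP] (k : nat) : exists x : V,
    enorm (coordv x) = 1 /\ Nv x <= k.+1%:R^-1.
  apply: contrapT => nox; apply: noC; exists k.+1%:R => // x.
  rewrite leNgt; apply/negP => xk; apply: nox.
  have x0 : 0 < enorm (coordv x).
    by apply: le_lt_trans xk; rewrite mulr_ge0// is_norm_ge0.
  have xV : cmod (to_complex (of_real s (enorm (coordv x))^-1)) = (enorm (coordv x))^-1.
    by rewrite to_complex_of_real cmod_real ger0_norm// invr_ge0 ltW.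
  exists (of_real s (enorm (coordv x))^-1 *: x); split.
    by rewrite coordvZ enormZ xV mulVf// gt_eqF.
  rewrite (norm_scale NvP) xV ler_pdivrMl// ler_pdivlMr//.
  by rewrite mulrC ltW.
have [|y yP] := @bounded_rV_cluster R _ (fun k => coordv (u k)) 1.
  by move=> k; rewrite (uP k).1.
pose x : V := vecof (vbasis {:V}) (map_mx (@of_complex R s) y).
have ux k : enorm (coordv (u k - x)) <= enorm (coordv (u k) - y).
  rewrite /enorm ler_sum// => i _; rewrite ler_sum// => j _.
  rewrite /coordv linearB /= /x vecofK ?vbasisP// !mxE.
  exact: cmod_of_complex.
have Nx : Nv x = 0.
  apply/eqP; rewrite eq_le is_norm_ge0 andbT; apply/ler_addgt0Pr => e e0.
  rewrite add0r; pose e' := e / 2 / (C + 1).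
  have e'0 : 0 < e' by rewrite !divr_gt0// ltr_wpDl.
  have [k ek uy] := yP e' (Num.truncn (2 / e)) e'0.
  rewrite -[x](subrK (u k)); apply: le_trans (norm_triangle NvP _ _) _.
  rewrite [e]splitr lerD//.
    rewrite -is_normN opprB; apply: le_trans (NC _) _.
    apply: le_trans (ler_wpM2l C0 (le_trans (ux k) uy)) _.
    rewrite /e' mulrCA ler_piMr ?divr_ge0// ?(ltW e0)//.
    by rewrite ler_pdivrMr ?mul1r ?ltr_wpDl// lerDl.
  apply: le_trans (uP k).2 _.
  rewrite -[e / 2]invrK lef_pV2 ?posrE ?invr_gt0 ?divr_gt0//.
  by rewrite invf_div ltW// (lt_le_trans (truncnS_gt _))// ler_nat.
have [|k _ uy] := yP (2^-1) 0%N; first by rewrite invr_gt0.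
have := ux k; rewrite (norm_eq0 NvP Nx) subr0 (uP k).1.
by have := uy; lra.
Qed.

End Coordinates.

Section OperatorNorm.
Variables (R : realType) (s : scalars) (xi : triplet R s) (N : multinorm xi).

Lemma mnorm_coord_equiv : exists2 C, 0 < C & forall i (x : Defs.space i),
  mnorm N x <= C * enorm (coordv x) /\ enorm (coordv x) <= C * mnorm N x.
Proof.
have /choice[a aP] (i : 'I_(nvert xi)) : exists a : R, 0 <= a /\
    forall x : Defs.space i, mnorm N x <= a * enorm (coordv x).
  by have [a ? ?] := is_norm_le_coord (mnormP N i); exists a.
have /choice[b bP] (i : 'I_(nvert xi)) : exists b : R, 0 <= b /\
    forall x : Defs.space i, enorm (coordv x) <= b * mnorm N x.
  by have [b ? ?] := coord_le_is_norm (mnormP N i); exists b.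
have a0 i : 0 <= a i := (aP i).1; have b0 i : 0 <= b i := (bP i).1.
have leS i : a i + b i <= 1 + \sum_j (a j + b j).
  rewrite (bigD1 i)//= addrCA lerDl addr_ge0// sumr_ge0// => j _.
  by rewrite addr_ge0.
exists (1 + \sum_j (a j + b j)).
  by rewrite ltr_pwDl// sumr_ge0// => j _; rewrite addr_ge0.
move=> i x; split.
  apply: le_trans ((aP i).2 x) _; rewrite ler_wpM2r ?enorm_ge0//.
  by apply: le_trans (leS i); rewrite lerDl.
apply: le_trans ((bP i).2 x) _; rewrite ler_wpM2r ?(is_norm_ge0 (mnormP N i))//.
by apply: le_trans (leS i); rewrite lerDr.
Qed.

Lemma sup_le_ge0 (S : set R) (M : R) : 0 <= M -> ubound S M -> sup S <= M.
Proof.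
move=> M0 SM; have [->|/set0P S0] := eqVneq S set0; first by rewrite sup0.
exact: ge_sup.
Qed.

Lemma opnorm_equiv : exists2 C, 0 < C & forall i j (f : 'Hom(Defs.space i, Defs.space j)),
  [/\ 0 <= opnorm N f, opnorm N f <= C * enorm (coordm f)
    & enorm (coordm f) <= C * opnorm N f].
Proof.
have [C C0 CP] := mnorm_coord_equiv.
have n0 i := is_norm_ge0 (mnormP N i).
have mx_bound i j (f : 'Hom(Defs.space i, Defs.space j)) x :
    mnorm N (f x) <= C * C * enorm (coordm f) * mnorm N x.
  apply: le_trans (CP _ _).1 _; rewrite coordv_app -!mulrA ler_pM2l//.
  apply: le_trans (enormM _ _) _; rewrite mulrCA mulrC ler_wpM2l ?enorm_ge0//.
  exact: (CP _ _).2.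
have ub i j (f : 'Hom(Defs.space i, Defs.space j)) : ubound
    [set r | exists x : Defs.space i, mnorm N x = 1 /\ r = mnorm N (f x)]
    (C * C * enorm (coordm f)).
  by move=> _ [x [x1 ->]]; have := mx_bound _ _ f x; rewrite x1 mulr1.
have mem i j (f : 'Hom(Defs.space i, Defs.space j)) x : mnorm N x = 1 ->
    mnorm N (f x) <= opnorm N f.
  move=> x1; apply: ub_le_sup; last by exists x.
  by exists (C * C * enorm (coordm f)); exact: ub.
have op_ge0 i j (f : 'Hom(Defs.space i, Defs.space j)) : 0 <= opnorm N f.
  rewrite /opnorm; set S := [set r | _].
  have [->|/set0P[r [x [x1 _]]]] := eqVneq S set0; first by rewrite sup0.
  exact: le_trans (n0 _ _) (mem _ _ f x x1).
have app i j (f : 'Hom(Defs.space i, Defs.space j)) x :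
    mnorm N (f x) <= opnorm N f * mnorm N x.
  have [x0|x0] := eqVneq (mnorm N x) 0.
    rewrite (norm_eq0 (mnormP N i) x0) linear0.
    by rewrite !(is_norm0 (mnormP N _)) mulr0.
  have xp : 0 < mnorm N x by rewrite lt_def x0 n0.
  have xV : cmod (to_complex (of_real s (mnorm N x)^-1)) = (mnorm N x)^-1.
    by rewrite to_complex_of_real cmod_real ger0_norm// invr_ge0 ltW.
  have := mem _ _ f (of_real s (mnorm N x)^-1 *: x).
  rewrite linearZ !(norm_scale (mnormP N _)) xV mulVf// => /(_ erefl).
  by rewrite ler_pdivrMl// mulrC.
pose D := \sum_(i < nvert xi)
  \sum_(a < \dim {:Defs.space i}) mnorm N (vbasis {:Defs.space i})`_a.
have S0 i : 0 <= \sum_(a < \dim {:Defs.space i}) mnorm N (vbasis {:Defs.space i})`_a.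
  by apply: sumr_ge0 => a _; exact: n0.
have D0 : 0 <= D by apply: sumr_ge0.
exists (C * C + C * D); first by rewrite ltr_pwDl ?mulr_gt0// mulr_ge0 ?(ltW C0).
move=> i j f; split => //.
  apply: le_trans (_ : C * C * enorm (coordm f) <= _).
    by apply: sup_le_ge0 (ub _ _ f); rewrite !mulr_ge0 ?enorm_ge0 ?(ltW C0).
  by rewrite ler_wpM2r ?enorm_ge0// lerDl mulr_ge0 ?(ltW C0).
apply: le_trans (_ : C * D * opnorm N f <= _); last first.
  by rewrite ler_wpM2r// lerDr mulr_ge0 ?(ltW C0).
rewrite enorm_rows; apply: (le_trans (y := \sum_(a < \dim {:Defs.space i})
    C * (opnorm N f * mnorm N (vbasis {:Defs.space i})`_a))).
  apply: ler_sum => a _; rewrite rowE -coordv_basis -coordv_app.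
  by apply: le_trans (CP _ _).2 _; rewrite ler_pM2l.
rewrite -!mulr_sumr -mulrA ler_pM2l// mulrC ler_wpM2r ?op_ge0//.
by rewrite /D (bigD1 i)//= lerDl; apply: sumr_ge0 => k _; exact: S0.
Qed.

End OperatorNorm.

(** * Paths as words of matrices on the direct sum *)

Section PathWords.
Variables (R : realType) (s : scalars) (xi : triplet R s).
Local Notation nv := (nvert xi).
Local Notation dim i := (\dim {:@Defs.space R s xi i}).

Definition coord_index := {i : 'I_nv & 'I_(dim i)}.
Definition total_dim := #|{: coord_index}|.

(** The coordinate inclusion of the [i]-th summand into the direct sum; its
    transpose is the projection, since vectors are rows. *)
Definition coord_incl i : 'M[R[i]]_(dim i, total_dim) :=
  \matrix_(a, b) (enum_rank (Tagged (fun i => 'I_(dim i)) a) == b)%:R.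

Lemma coord_incl_mul_tr i j : coord_incl i *m (coord_incl j)^T =
  \matrix_(a, b) (Tagged (fun i => 'I_(dim i)) a == Tagged (fun i => 'I_(dim i)) b)%:R.
Proof.
apply/matrixP => a b; rewrite !mxE (bigD1 (enum_rank (Tagged _ a)))//= !mxE eqxx mul1r.
rewrite (inj_eq enum_rank_inj) eq_sym big1 ?addr0// => k ka.
by rewrite !mxE eq_sym (negbTE ka) mul0r.
Qed.

Lemma coord_incl_trK i : coord_incl i *m (coord_incl i)^T = 1%:M.
Proof.
rewrite coord_incl_mul_tr; apply/matrixP => a b; rewrite !mxE.
by rewrite -tag_eqE /tag_eq /= eqxx tagged_asE.
Qed.

Lemma coord_incl_tr_neq i j : i != j -> coord_incl i *m (coord_incl j)^T = 0.
Proof.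
move=> ij; rewrite coord_incl_mul_tr; apply/matrixP => a b; rewrite !mxE.
by rewrite -tag_eqE /tag_eq /= (negbTE ij).
Qed.

Definition edges := {ij : 'I_nv * 'I_nv & edge ij.1 ij.2}.

Definition edge_mx (e : edges) : 'M[R[i]]_total_dim :=
  (coord_incl (tag e).1)^T *m coordm (op (tagged e)) *m coord_incl (tag e).2.

(** Only the rows of the [i]-th block are compared: the empty path at [i]
    corresponds to the empty word, whose matrix is the identity on all blocks. *)
Lemma path_word i j (p : gpath i j) : exists2 w,
  size w = plen p & coord_incl i *m word_mx edge_mx w = coordm (pprod p) *m coord_incl j.
Proof.
elim: p => [k|k j' l p [w wp wE] e] /=.
  by exists [::]; rewrite // word_nil mulmx1 coordm1 mul1mx.
exists (rcons w (Tagged (fun ij : 'I_nv * 'I_nv => edge ij.1 ij.2)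
    (e : edge (j', l).1 (j', l).2))).
  by rewrite size_rcons wp.
rewrite word_rcons mulmxA wE /edge_mx /= coordm_comp !mulmxA.
by rewrite -(mulmxA _ (coord_incl j')) coord_incl_trK mulmx1.
Qed.

(** Consecutive edges that do not share a vertex multiply to zero. *)
Lemma word_path w : (0 < size w)%N ->
  word_mx edge_mx w = 0 \/ exists i j (p : gpath i j),
    plen p = size w /\
    word_mx edge_mx w = (coord_incl i)^T *m coordm (pprod p) *m coord_incl j.
Proof.
elim/last_ind: w => // w [[j' l] e] IH _; rewrite word_rcons size_rcons.
have [w0|w0] := posnP (size w).
  right; exists j', l, (gpath_rcons (gpath_nil j') e).
  by rewrite (size0nil w0) word_nil mul1mx /= coordm_comp coordm1 mul1mx.
case: (IH w0) => [->|[i [j [p [pw ->]]]]]; first by left; rewrite mul0mx.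
rewrite /edge_mx /=; have [ejj|jj] := eqVneq j j'; last first.
  left; rewrite !mulmxA -(mulmxA _ (coord_incl j)) coord_incl_tr_neq//.
  by rewrite mulmx0 !mul0mx.
right; move: e; rewrite -ejj => e; exists i, l, (gpath_rcons p e).
rewrite /= pw coordm_comp !mulmxA; split=> //.
by rewrite -(mulmxA _ (coord_incl j)) coord_incl_trK mulmx1.
Qed.

End PathWords.

Section ScaledWords.
Variables (R : realType).

Lemma word_scale (E : finType) n (A : E -> 'M[R[i]]_n) a w :
  word_mx (fun e => a *: A e) w = a ^+ size w *: word_mx A w.
Proof.
elim: w => [|e w IH]; first by rewrite !word_nil scale1r.
by rewrite !word_cons IH -scalemxAl -scalemxAr scalerA exprS.
Qed.

Lemma word_le_exp (E : finType) n (A : E -> 'M[R[i]]_n) : exists2 a,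
  1 <= a & forall w, enorm (word_mx A w) <= enorm (1%:M : 'M[R[i]]_n) * a ^+ size w.
Proof.
exists (1 + \sum_e enorm (A e)); 
  first by rewrite lerDl sumr_ge0// => e _; exact: enorm_ge0.
have a0 : 0 <= \sum_e enorm (A e) by rewrite sumr_ge0// => e _; exact: enorm_ge0.
elim=> [|e w IH] /=; first by rewrite word_nil mulr1.
rewrite word_cons; apply: le_trans (enormM _ _) _.
rewrite exprS mulrCA; apply: ler_pM => //; rewrite ?enorm_ge0//.
rewrite (bigD1 e)//= addrCA lerDl addr_ge0// sumr_ge0// => k _.
exact: enorm_ge0.
Qed.

Lemma root_le (o x : R) k : 0 <= o -> 0 <= x -> (0 < k)%N ->
  (o `^ k%:R^-1 <= x) = (o <= x ^+ k).
Proof.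
move=> o0 x0 k0; have k0' : k%:R != 0 :> R by rewrite pnatr_eq0 -lt0n.
apply/idP/idP => [ox|ox].
  have -> : o = (o `^ k%:R^-1) ^+ k.
    by rewrite -powR_mulrn ?powR_ge0// -powRrM mulVf// powRr1.
  by rewrite ler_pXn2r ?nnegrE ?powR_ge0.
have -> : x = (x ^+ k) `^ k%:R^-1.
  by rewrite -powR_mulrn// -powRrM mulfV// powRr1.
by rewrite ge0_ler_powR ?invr_ge0 ?nnegrE ?exprn_ge0.
Qed.

End ScaledWords.

(** * Normalization by the joint spectral radius *)

Section Normalization.
Variables (R : realType) (s : scalars) (xi : triplet R s) (N : multinorm xi).

(** The limit of a divergent sequence is 0 by convention, so a positive limit
    means convergence. *)
Lemma max_norm_root_cvg : 0 < jsr N -> max_norm_root N @ \oo --> jsr N.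
Proof.
move=> rho0; apply: contrapT => dvg.
have : jsr N = point by apply: dvgP => cv; exact: dvg.
by move=> rhoE; move: rho0; rewrite rhoE ltxx.
Qed.

Lemma coord_incl_bounded : exists2 c, 0 < c & forall i : 'I_(nvert xi),
  enorm (coord_incl i) <= c /\ enorm (coord_incl i)^T <= c.
Proof.
pose f (i : 'I_(nvert xi)) := enorm (coord_incl i) + enorm (coord_incl i)^T.
have f0 i : 0 <= f i by rewrite addr_ge0 ?enorm_ge0.
exists (1 + \sum_i f i); first by rewrite ltr_pwDl// sumr_ge0.
move=> i; have fi : f i <= 1 + \sum_i f i.
  by rewrite (bigD1 i)//= addrCA lerDl addr_ge0// sumr_ge0.
by split; apply: le_trans fi; rewrite /f ?lerDl ?lerDr enorm_ge0.
Qed.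

Lemma path_word_equiv : exists2 C, 0 < C &
  (forall i j (p : @gpath R s xi i j), exists2 w, size w = plen p &
     opnorm N (pprod p) <= C * enorm (word_mx (@edge_mx R s xi) w)) /\
  (forall w (b : R), (0 < size w)%N -> 0 <= b ->
     (forall i j (p : @gpath R s xi i j), plen p = size w -> opnorm N (pprod p) <= b) ->
     enorm (word_mx (@edge_mx R s xi) w) <= C * b).
Proof.
have [C C0 CP] := opnorm_equiv N; have [c c0 cP] := coord_incl_bounded.
exists (C * (c * c)); first by rewrite !mulr_gt0.
split=> [i j p|w b w0 b0 wb].
  have [w wp wE] := path_word p; exists w => //.
  have [_ pC _] := CP _ _ (pprod p); apply: le_trans pC _.
  rewrite -mulrA ler_pM2l// -[coordm _]mulmx1 -(coord_incl_trK j) mulmxA -wE.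
  apply: le_trans (enormM _ _) _; rewrite mulrAC.
  apply: ler_pM; rewrite ?enorm_ge0//; last exact: (cP j).2.
  by apply: le_trans (enormM _ _) _; rewrite ler_wpM2r ?enorm_ge0// (cP i).1.
case: (word_path w0) => [->|[i [j [p [pw ->]]]]].
  by rewrite enorm0 !mulr_ge0// ltW.
apply: le_trans (enormM _ _) _.
apply: le_trans (ler_wpM2r (enorm_ge0 _) (enormM _ _)) _.
have [_ _ pC] := CP _ _ (pprod p).
have pb : enorm (coordm (pprod p)) <= C * b.
  by apply: le_trans pC _; rewrite ler_pM2l// wb.
apply: le_trans (_ : c * (C * b) * c <= _).
  apply: ler_pM; rewrite ?mulr_ge0 ?enorm_ge0//; last exact: (cP j).1.
  by apply: ler_pM; rewrite ?enorm_ge0//; exact: (cP i).2.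
by rewrite [leLHS](_ : _ = C * (c * c) * b)//; ring.
Qed.

Lemma opnorm_ge0 i j (f : 'Hom(Defs.space i, Defs.space j)) : 0 <= opnorm N f.
Proof. by have [C _ CP] := opnorm_equiv N; have [] := CP _ _ f. Qed.

Lemma root_opnorm_le i j (p : @gpath R s xi i j) : (0 < plen p)%N ->
  opnorm N (pprod p) `^ ((plen p)%:R^-1) <= max_norm_root N (plen p).
Proof.
move=> p0; set k := plen p in p0 *.
pose S := [set r | exists (i j : 'I_(nvert xi)) (p : gpath i j),
  plen p = k /\ r = (opnorm N (pprod p)) `^ (k%:R^-1)].
have Sub : has_ubound S.
  have [C C0 [pC _]] := path_word_equiv.
  have [a a1 aP] := word_le_exp (@edge_mx R s xi).
  pose x := 1 + C * (enorm (1%:M : 'M[R[i]]_(total_dim xi)) * a ^+ k).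
  have x1 : 1 <= x.
    by rewrite lerDl !mulr_ge0 ?enorm_ge0 ?exprn_ge0 ?ltW// (lt_le_trans ltr01 a1).
  exists x => _ [i' [j' [q [qk ->]]]].
  rewrite root_le ?opnorm_ge0 ?(le_trans ler01 x1)//.
  apply: le_trans (ler_eXnr p0 x1); have [w wq qw] := pC _ _ q.
  apply: le_trans qw _; rewrite /x ler_wpDl// ler_pM2l// -qk -wq; exact: aP.
by apply: ub_le_sup => //; exists i, j, p.
Qed.

Hypothesis rho_gt0 : 0 < jsr N.

Definition normalized_edge_mx (e : edges xi) := ((jsr N)^-1)%:C%C *: edge_mx e.

Lemma word_normalized w : word_mx normalized_edge_mx w =
  (((jsr N)^-1)%:C%C ^+ size w) *: word_mx (@edge_mx R s xi) w.
Proof. exact: word_scale. Qed.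

Lemma enorm_word_normalized w : enorm (word_mx normalized_edge_mx w) =
  jsr N ^- size w * enorm (word_mx (@edge_mx R s xi) w).
Proof.
by rewrite word_normalized enormZ cmodX cmod_real ger0_norm ?invr_ge0 ?ltW// exprVn.
Qed.

(** Convergence of the roots controls all long paths; the finitely many short
    lengths only change the constant. *)
Lemma subexponential_normalized : subexponential normalized_edge_mx.
Proof.
move=> r r1; have rho0 := rho_gt0; have r0 := lt_trans ltr01 r1.
have [K _ KP] : \forall k \near \oo, max_norm_root N k < jsr N * r.
  by apply: (cvgr_lt _ (max_norm_root_cvg rho0)); rewrite ltr_pMr.
have [C C0 [_ wC]] := path_word_equiv.
have [a a1 aP] := word_le_exp normalized_edge_mx.
set D := enorm 1%:M in aP; have D0 : 0 <= D := enorm_ge0 _.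
exists (D * a ^+ K + C) => w.
have aK : 0 <= D * a ^+ K by rewrite mulr_ge0// exprn_ge0// (le_trans ler01).
have rw : 1 <= r ^+ size w by rewrite exprn_ege1// ltW.
have [wK|Kw] := leqP (size w) K.
  apply: le_trans (aP w) _; apply: le_trans (_ : D * a ^+ K <= _).
    by rewrite ler_wpM2l// ler_weXn2l.
  apply: le_trans (_ : (D * a ^+ K + C) * 1 <= _); first by rewrite mulr1 lerDl ltW.
  by rewrite ler_wpM2l// addr_ge0// ltW.
apply: le_trans (_ : C * r ^+ size w <= _); last first.
  by rewrite ler_wpM2r ?lerDr// (le_trans ler01).
rewrite enorm_word_normalized mulrC ler_pdivrMr ?exprn_gt0// -mulrA -exprMn.
apply: wC; rewrite ?(leq_ltn_trans _ Kw)//.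
  by rewrite exprn_ge0// mulr_ge0 ?ltW.
move=> i j p pw; rewrite -pw; have p0 : (0 < plen p)%N.
  by rewrite pw (leq_ltn_trans _ Kw).
rewrite -root_le ?opnorm_ge0 ?mulr_ge0 ?(ltW r0) ?(ltW rho0)//.
apply: le_trans (root_opnorm_le p0) _.
by rewrite mulrC ltW// KP//= pw ltnW.
Qed.

(** If all words of some length were small, words would decay exponentially, and
    the roots of the norms would converge to a limit below the joint spectral
    radius. *)
Lemma nondecaying_normalized : nondecaying normalized_edge_mx.
Proof.
apply: contrapT => nd; have rho0 := rho_gt0.
have [|k kP] := @not_nondecaying_small _ _ _ _ 2^-1 nd; first by rewrite invr_gt0.
(* If the identity itself is small, the dimension is 0 and every word is small. *)
have [l l0 lP] : exists2 l, (0 < l)%N & forall w, size w = l ->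
    enorm (word_mx normalized_edge_mx w) <= 2^-1.
  case: k kP => [k0|k kP]; last by exists k.+1.
  exists 1%N => // w _.
  have := enorm_word_catM normalized_edge_mx w [::].
  rewrite cats0 => /le_trans-/(_ _ (ler_wpM2l (enorm_ge0 _) (k0 [::] erefl))).
  have := enorm_ge0 (word_mx normalized_edge_mx w); lra.
(* With [t ^+ (2 * l) = 2], words of length [n = m.+1 * l] are at most [t ^- (2 * n)];
   half of this decay absorbs the constant [C]. *)
have [t t1 tl] := @root_gt1 R 2 (l.*2).-1 (ltr1n R 2).
rewrite prednK ?double_gt0// in tl.
have t0 := lt_trans ltr01 t1.
have [C C0 [pC _]] := path_word_equiv.
have [K CK] := expr_unbounded C t1.
have [K' _ K'P] : \forall k \near \oo, jsr N / t < max_norm_root N k.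
  by apply: (cvgr_gt _ (max_norm_root_cvg rho0)); rewrite ltr_pdivrMr// ltr_pMr.
pose m := maxn K K'; pose n := (m.+1 * l)%N.
have mn : (m < n)%N by rewrite /n leq_pmulr.
have := K'P n; rewrite /= (leq_trans (leq_maxr K K') (ltnW mn)) => /(_ isT).
apply/negP; rewrite -leNgt; apply: sup_le_ge0; first by rewrite divr_ge0 ?ltW.
move=> _ [i [j [p [pn ->]]]].
rewrite root_le ?opnorm_ge0 ?divr_ge0 ?(ltW t0) ?(ltW rho0)//;
  last exact: leq_ltn_trans (leq0n m) mn.
have [w wp pw] := pC _ _ p; apply: le_trans pw _.
have : enorm (word_mx normalized_edge_mx w) <= 2^-1 ^+ m.+1.
  apply: (submult_decay
    (f := fun w => enorm (word_mx normalized_edge_mx w)) (k := l)) => //.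
  - by move=> v; exact: enorm_ge0.
  - exact: enorm_word_catM.
  - by rewrite wp pn.
rewrite enorm_word_normalized wp pn mulrC ler_pdivrMr ?exprn_gt0// => wn.
apply: le_trans (ler_wpM2l (ltW C0) wn) _.
have -> : 2^-1 ^+ m.+1 = (t ^+ n * t ^+ n)^-1.
  by rewrite exprVn -tl -exprM -exprD addnn /n -doubleMl mulnC.
have tn0 : 0 < t ^+ n by rewrite exprn_gt0.
rewrite expr_div_n invfM.
rewrite [leLHS](_ : _ = C / t ^+ n * (jsr N ^+ n / t ^+ n)); last by ring.
rewrite ler_piMl ?divr_ge0 ?exprn_ge0 ?(ltW t0) ?(ltW rho0)//.
rewrite ler_pdivrMr// mul1r; apply: le_trans (ltW CK) _.
apply: ler_weXn2l; first exact: ltW.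
exact: leq_trans (leq_maxl K K') (ltnW mn).
Qed.

End Normalization.

Section EigenvaluesOfPaths.
Variables (R : realType) (s : scalars) (xi : triplet R s).

Lemma eigenvalue_path_word i (p : @gpath R s xi i i) z :
  eigenvalue (coordm (pprod p)) z ->
  exists2 w, size w = plen p & eigenvalue (word_mx (@edge_mx R s xi) w) z.
Proof.
move=> /eigenvalueP[v vM v0]; have [w wp wE] := path_word p.
exists w => //; apply/eigenvalueP; exists (v *m coord_incl i).
  by rewrite -mulmxA wE mulmxA vM scalemxAl.
apply: contra v0 => /eqP v0.
by rewrite -[v]mulmx1 -coord_incl_trK mulmxA v0 mul0mx.
Qed.

(** For a path that is not closed, the matrix of the word has square zero, so it
    has no other eigenvalue than 0. *)
Lemma eigenvalue_word_path w z : (0 < size w)%N -> z != 0 ->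
  eigenvalue (word_mx (@edge_mx R s xi) w) z ->
  exists i (p : @gpath R s xi i i),
    plen p = size w /\ eigenvalue (coordm (pprod p)) z.
Proof.
move=> w0 z0 /eigenvalueP[v]; case: (word_path w0) => [->|].
  rewrite mulmx0 => /esym/eqP; rewrite scaler_eq0 (negbTE z0) /=.
  by move=> ->.
move=> [i [j [p [pw ->]]]] vM v0.
have u0 : v *m (coord_incl i)^T != 0.
  apply: contra v0 => /eqP u0; move/eqP: vM.
  by rewrite !mulmxA u0 !mul0mx eq_sym scaler_eq0 (negbTE z0).
have := congr1 (mulmx^~ (coord_incl i)^T) vM.
rewrite -!mulmxA; have [ij|ij] := eqVneq i j; last first.
  rewrite coord_incl_tr_neq 1?eq_sym// !mulmx0 -scalemxAl => /esym/eqP.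
  by rewrite scaler_eq0 (negbTE z0) (negbTE u0).
move: p pw vM; rewrite -ij => p pw _ vM.
exists i, p; split => //; apply/eigenvalueP; exists (v *m (coord_incl i)^T) => //.
by move: vM; rewrite coord_incl_trK mulmx1 -scalemxAl mulmxA.
Qed.

End EigenvaluesOfPaths.

Lemma eigenvalue_scale (F : fieldType) n (M : 'M[F]_n) a z :
  a != 0 -> eigenvalue (a *: M) z = eigenvalue M (a^-1 * z).
Proof.
move=> a0; apply/eigenvalueP/eigenvalueP => -[v vM v0]; exists v => //.
  by rewrite -scalerA -vM -scalemxAr scalerA mulVf// scale1r.
by rewrite -scalemxAr vM scalerA mulrA mulfV// mul1r.
Qed.

Section SpectralRadius.
Variables (R : realType) (s : scalars) (xi : triplet R s) (N : multinorm xi).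
Hypothesis rho_gt0 : 0 < jsr N.

Let normalizer_neq0 k : ((jsr N)^-1)%:C%C ^+ k != 0.
Proof.
rewrite expf_neq0// -(rmorph0 (real_complex R)) (inj_eq (@complexI R)).
by rewrite invr_eq0 gt_eqF.
Qed.

Let cmod_normalizer k : cmod (((jsr N)^-1)%:C%C ^+ k) = jsr N ^- k.
Proof. by rewrite cmodX cmod_real ger0_norm ?invr_ge0 ?ltW// exprVn. Qed.

Lemma eigenvalue_closed_path_le i (p : @gpath R s xi i i) z :
  eigenvalue (coordm (pprod p)) z -> cmod z <= jsr N ^+ plen p.
Proof.
have rho0 := rho_gt0.
move=> /eigenvalue_path_word[w <- wz].
have := @subexponential_eigenvalue_le1 _ _ _ _ w
  (((jsr N)^-1)%:C%C ^+ size w * z) (subexponential_normalized rho_gt0).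
rewrite word_normalized eigenvalue_scale ?normalizer_neq0//.
rewrite mulKf ?normalizer_neq0// => /(_ wz).
by rewrite cmodM cmod_normalizer ler_pdivrMl ?exprn_gt0// mulr1.
Qed.

Lemma spectral_radius_le i (p : @gpath R s xi i i) :
  spectral_radius (pprod p) <= jsr N ^+ plen p.
Proof.
apply: sup_le_ge0; first by rewrite exprn_ge0 ?ltW.
by move=> _ [z [pz ->]]; exact: eigenvalue_closed_path_le pz.
Qed.

Lemma max_closed_spectral_radius_le k :
  max_closed_spectral_radius xi k <= jsr N ^+ k.
Proof.
apply: sup_le_ge0; first by rewrite exprn_ge0 ?ltW.
by move=> _ [i [p [<- ->]]]; exact: spectral_radius_le.
Qed.

Lemma cmod_le_max_closed i (p : @gpath R s xi i i) z :
  eigenvalue (coordm (pprod p)) z ->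
  cmod z <= max_closed_spectral_radius xi (plen p).
Proof.
move=> pz; apply: (le_trans (y := spectral_radius (pprod p))).
  apply: ub_le_sup; last by exists z.
  exists (jsr N ^+ plen p) => _ [y [py ->]].
  exact: eigenvalue_closed_path_le py.
apply: ub_le_sup; last by exists i, p.
exists (jsr N ^+ plen p) => _ [j [q [<- ->]]]; exact: spectral_radius_le.
Qed.

Lemma max_closed_frequently (eps : R) K : 0 < eps -> exists2 k, (K <= k)%N &
  1 - eps <= jsr N ^- k * max_closed_spectral_radius xi k.
Proof.
move=> eps0; have rho0 := rho_gt0.
(* Below 1, so that the eigenvalue is not 0 and the word is a closed path. *)
pose e := Num.min eps 2^-1.
have e0 : 0 < e by rewrite lt_min eps0 invr_gt0 ltr0n.
have e2 : e <= 2^-1 by rewrite ge_min lexx orbT.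
have ee : e <= eps by rewrite ge_min lexx.
have [w [z [Kw wz ez]]] := nondecaying_long_unit_eigenvalues
  (nondecaying_normalized rho_gt0) (subexponential_normalized rho_gt0) K.+1 e0.
have a0 := normalizer_neq0 (size w).
have z0 : z != 0.
  by apply/eqP => z0; move: ez; rewrite z0 cmod0; lra.
rewrite word_normalized eigenvalue_scale// in wz.
have [|i [p [pw pz]]] := eigenvalue_word_path (leq_ltn_trans (leq0n K) Kw) _ wz.
  by rewrite mulf_neq0// invr_eq0.
exists (size w); first exact: ltnW.
have := cmod_le_max_closed pz; rewrite pw => zmax.
apply: le_trans (_ : cmod z <= _); first by apply: le_trans ez; rewrite lerD2l lerN2.
rewrite -[z](mulVKf a0) cmodM cmod_normalizer ler_wpM2l//.
by rewrite invr_ge0 exprn_ge0 ?ltW.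
Qed.

End SpectralRadius.

Theorem theorem4 (R : realType) (s : scalars) (xi : triplet R s)
    (N : multinorm xi) (jsr_gt0 : 0 < jsr N) :
  limn_esup (fun k : nat =>
    (jsr N ^- k * max_closed_spectral_radius xi k)%:E) = 1%E.
Proof.
apply/eqP; rewrite eq_le /limn_esup limf_esupE; apply/andP; split.
  apply: le_trans (ereal_inf_lbound _) _; first by exists setT => //; exact: filterT.
  apply: ge_ereal_sup => _ [k _ <-].
  rewrite lee_fin ler_pdivrMl ?exprn_gt0// mulr1.
  exact: max_closed_spectral_radius_le.
apply: le_ereal_inf_tmp => _ [V [K _ KV] <-].
apply/lee_subgt0Pr => eps eps0.
have [k Kk ek] := max_closed_frequently jsr_gt0 K eps0.
apply: le_trans (ereal_sup_ubound _); last by exists k => //; exact: KV.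
by rewrite -EFinB lee_fin.
Qed.
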